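(* Let $\Omega$ be a nonempty finite set and let $\mathscr P$ be a finitely generated binary quadratic operad. Then $$\mathscr P^{\mathrm{LC}}_\Omega\cong \mathscr{L}ie^{\mathrm{LC}}_\Omega\bullet\mathscr P\qquad\text{and}\qquad \mathscr P^{\mathrm{TC}}_\Omega\cong\mathscr{C}om^{\mathrm{TC}}_\Omega\circledcirc\mathscr P ,$$ where $\bullet$ denotes the Manin black product and $\circledcirc$ the Manin white product of operads.
   Context: $\mathbf k$ is a field of characteristic zero; operads are symmetric operads of $\mathbf k$-vector spaces, assumed reduced. For an $\mathbb S$-module $M$ with basis $X$, the free operad $\mathscr T(M)$ is spanned by decorated planar rooted trees $(t,d)$ with labelled leaves (modulo the usual identifications from the symmetric group actions). A finitely generated binary quadratic operad is $\mathscr P=\mathscr T(M)/\langle R\rangle$ with $M=M(2)$ finite dimensional and $R\subseteq\mathscr T(M)(3)$, the span of trees with two vertices. $\mathscr{L}ie$ and $\mathscr{C}om$ are the operads of Lie algebras and of commutative (associative) algebras with their standard binary quadratic presentations. Compatible operads. For $\omega\in\Omega$ let $M_\omega$ be a copy of $M$ with basis $X_\omega=\{x_\omega\mid x\in X\}$. $C(\Omega,2)$ is the set of maps $c:\Omega\to\mathbb Z_{\ge0}$ with $\sum_\omega c_\omega=2$. For a decorated tree $(t,d)$ with two vertices, $\mathrm{Col}(d,c)$ is the set of decorations $D$ of $t$ obtained by attaching a label in $\Omega$ to each $d(v)$ (replacing $x$ by $x_\omega$) so that each $\omega$ is used exactly $c_\omega$ times. Write $r=\sum_{i=0}^s\alpha_i(t_i,d_i)\in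 R$ with $\alpha_i\neq 0$, distinct $(t_i,d_i)$. (LC) $\mathscr P^{\mathrm{LC}}_\Omega=\mathscr T(\bigoplus_\omega M_\omega)/\langle r_c\mid r\in R,\ c\in C(\Omega,2)\rangle$, where $r_c=\sum_i\alpha_i\sum_{D\in\mathrm{Col}(d_i,c)}(t_i,D)$. (TC) $\mathscr P^{\mathrm{TC}}_\Omega=\mathscr T(\bigoplus_\omega M_\omega)/\langle R_{\mathrm{MT}}\cup R_{\mathrm{TC}}\rangle$, where $R_{\mathrm{TC}}=\{(t_i,\delta)-(t_i,\tau)\mid r\in R,\ 0\le i\le s,\ c\in C(\Omega,2),\ \delta,\tau\in\mathrm{Col}(d_i,c)\}$ and $R_{\mathrm{MT}}$ is any matching compatibility of $R$; the quotient does not depend on the choice, and one may take the leveled one, consisting of the relations obtained from each $r\in R$ by attaching, for $\mu,\nu\in\Omega$, the label $\mu$ to the root vertex and the label $\nu$ to the other vertex in every term. Manin products. Let $\mathscr P=\mathscr T(M)/\langle R\rangle$, $\mathscr Q=\mathscr T(N)/\langle S\rangle$ be finitely generated binary quadratic. Every element of $\mathscr T(M)(3)$ is a combination of left combs $(\mu_i;\mu_j)_{abc}$ (upper vertex $\mu_i$ with inputs $a,b$; root vertex $\mu_j$ with inputs the upper vertex and $c$) with $(a,b,c)\in\{(1,2,3),(2,3,1),(3,1,2)\}$. White product: $\mathscr P\circledcirc\mathscr Q=\mathscr T(M\otimes N)/\langle\Phi^{-1}(R\otimes\mathscr T(N)(3)+\mathscr T(M)(3)\otimes S)\rangle$, where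 $\Phi:\mathscr T(M\otimes N)(3)\to\mathscr T(M)(3)\otimes\mathscr T(N)(3)$ sends $(\mu_i\otimes\nu_k;\mu_j\otimes\nu_\ell)_{abc}$ to $(\mu_i;\mu_j)_{abc}\otimes(\nu_k;\nu_\ell)_{abc}$. Black product: $\mathscr P\bullet\mathscr Q=\mathscr T(M\otimes N\otimes\mathrm{sgn}_2)/\langle R\bullet S\rangle$, where $R\bullet S$ is the image of $R\otimes S$ under the map sending $(\mu_i;\mu_j)_{abc}\otimes(\nu_k;\nu_\ell)_{abc}$ to $(\mu_i\otimes\nu_k;\mu_j\otimes\nu_\ell)_{abc}$ and the product of trees with different $(a,b,c)$ to $0$ ($\mathrm{sgn}_2$ is the sign representation of $S_2$).
   Formalization: For the second isomorphism, when Ω has at least two elements, it is assumed that the decorated trees occurring in elements of R (written in left combs) generate T(M)(3) as an S_3-module; otherwise it fails, e.g. for R = 0, M = k[S_2], |Ω| = 2 (arity-3 dimensions 48 and 36). *)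

(* Defs.v *)
From HB Require Import structures.
From mathcomp Require Import all_boot all_order all_algebra all_fingroup.
From mathcomp Require Import boolp.
From mathcomp Require Import ring_quotient freeg zify.

Set Implicit Arguments.
Unset Strict Implicit.
Unset Printing Implicit Defensive.

Import GRing.Theory.
Local Open Scope ring_scope.

Inductive lspan (k : fieldType) (V : lmodType k) (G : V -> Prop) : V -> Prop :=
| Lspan_gen v : G v -> lspan G v
| Lspan0 : lspan G 0
| LspanD u v : lspan G u -> lspan G v -> lspan G (u + v)
| LspanZ c v : lspan G v -> lspan G (c *: v).

Record submodule (k : fieldType) (V : lmodType k) := Submodule {
  in_sub :> V -> Prop;
  in_sub0 : in_sub 0;
  in_subD : forall u v, in_sub u -> in_sub v -> in_sub (u + v);
  in_subZ : forall c v, in_sub v -> in_sub (c *: v)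
}.

Lemma in_subN (k : fieldType) (V : lmodType k) (W : submodule V) v :
  W v -> W (- v).
Proof. by move=> Wv; rewrite -scaleN1r; apply: in_subZ. Qed.

Lemma in_subB (k : fieldType) (V : lmodType k) (W : submodule V) u v :
  W u -> W v -> W (u - v).
Proof. by move=> Wu Wv; apply: in_subD => //; apply: in_subN. Qed.

Section ModuleQuotient.
Variables (k : fieldType) (V : lmodType k) (W : submodule V).

Definition subb (v : V) : bool := `[< W v >].

Lemma subb_zmod_closed : zmod_closed subb.
Proof.
split=> [|u v /asboolP Wu /asboolP Wv]; first by apply/asboolP; apply: in_sub0.
by apply/asboolP; apply: in_subB.
Qed.

Definition subb_closed : zmodClosed V :=
  HB.pack subb (GRing.isZmodClosed.Build V subb subb_zmod_closed).

Definition quot_mod : Type := Quotient.quot subb_closed.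

HB.instance Definition _ := GRing.Zmodule.on quot_mod.

Definition quot_proj (v : V) : quot_mod := \pi_(Quotient.quot subb_closed)%qT v.
Definition quot_repr (q : quot_mod) : V := generic_quotient.repr (q : Quotient.quot subb_closed).

Lemma quot_reprK : cancel quot_repr quot_proj.
Proof. exact: reprK. Qed.

Lemma quot_ind (P : quot_mod -> Prop) : (forall v, P (quot_proj v)) -> forall q, P q.
Proof. by move=> Pv q; rewrite -(quot_reprK q). Qed.

Lemma quot_projP u v : quot_proj u = quot_proj v <-> W (u - v).
Proof.
split=> [uv|Wuv].
  apply/asboolP; rewrite -[asbool _]/(u - v \in subb_closed) Quotient.idealrBE.
  exact/eqP.
by apply/eqP; rewrite /quot_proj -Quotient.idealrBE; apply/asboolP.
Qed.

Lemma quot_reprP v : W (quot_repr (quot_proj v) - v).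
Proof. by apply/quot_projP; rewrite quot_reprK. Qed.

Lemma quot_projD u v : quot_proj (u + v) = quot_proj u + quot_proj v.
Proof. by rewrite /quot_proj raddfD. Qed.

Definition quot_scale (c : k) (q : quot_mod) := quot_proj (c *: quot_repr q).

Lemma quot_projZ c v : quot_proj (c *: v) = quot_scale c (quot_proj v).
Proof.
apply/esym/quot_projP; rewrite -scalerBr.
exact/in_subZ/quot_reprP.
Qed.

Lemma quot_scaleA a b q : quot_scale a (quot_scale b q) = quot_scale (a * b) q.
Proof. by elim/quot_ind: q => v; rewrite -!quot_projZ scalerA. Qed.

Lemma quot_scale1 : left_id 1 quot_scale.
Proof. by elim/quot_ind=> v; rewrite -!quot_projZ scale1r. Qed.

Lemma quot_scaleDr : right_distributive quot_scale +%R.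
Proof.
move=> c; elim/quot_ind=> u; elim/quot_ind=> v.
by rewrite -!quot_projZ -!quot_projD -quot_projZ scalerDr.
Qed.

Lemma quot_scaleDl q : {morph quot_scale^~ q : a b / a + b}.
Proof.
move=> a b; elim/quot_ind: q => v.
by rewrite -!quot_projZ -!quot_projD scalerDl.
Qed.

HB.instance Definition _ := GRing.Zmodule_isLmodule.Build k quot_mod
  quot_scaleA quot_scale1 quot_scaleDr quot_scaleDl.

Lemma quot_proj_linear : linear quot_proj.
Proof. by move=> c u v; rewrite quot_projD quot_projZ. Qed.

HB.instance Definition _ :=
  GRing.isLinear.Build k V quot_mod *:%R quot_proj quot_proj_linear.

End ModuleQuotient.

(* A leaf (input) labelled j of a tree with m leaves, other than the leaf i,
   gets the label [outer i n j] when a tree with n leaves is grafted at i;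
   the leaf j of the grafted tree gets the label i + j.  Labels start at 0. *)
Definition outer (i n j : nat) : nat := (if j < i then j else (j + n).-1)%N.

(* rho is the permutation of the inputs of a \o_i b induced by s on the inputs
   of a and t on the inputs of b. *)
Definition comp_perm m n p (i : 'I_m) (s : 'S_m) (t : 'S_n) (rho : 'S_p) : Prop :=
  (forall (j : 'I_m) (j' : 'I_p), j != i -> j' = outer i n j :> nat ->
     rho j' = outer (s i) n (s j) :> nat) /\
  (forall (j : 'I_n) (j' : 'I_p), j' = (i + j)%N :> nat ->
     rho j' = (s i + t j)%N :> nat).

(* Reduced symmetric operads of k-modules, with partial compositions
   a \o_i b : O p for a : O m, b : O n, i < m, where p = m + n - 1; the proof
   of p + 1 = m + n is an argument, which avoids transports between equal
   arities.  [act s] renames the input i to s i; as (s * t) i = t (s i) for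
   permutations, it is a right action. *)
Record operad (k : fieldType) := Operad {
  op_car :> nat -> lmodType k;
  op_id : op_car 1;
  op_act : forall n, 'S_n -> op_car n -> op_car n;
  op_comp : forall m n p, p.+1 = (m + n)%N -> 'I_m ->
              op_car m -> op_car n -> op_car p;
  op_reduced : forall a : op_car 0, a = 0;
  op_act_linear : forall n (s : 'S_n), linear (op_act s);
  op_act1 : forall n (a : op_car n), op_act 1%g a = a;
  op_actM : forall n (s t : 'S_n) (a : op_car n),
    op_act (s * t)%g a = op_act t (op_act s a);
  op_compl_linear : forall m n p (h : p.+1 = (m + n)%N) (i : 'I_m) (b : op_car n),
    linear (fun a => op_comp h i a b);
  op_compr_linear : forall m n p (h : p.+1 = (m + n)%N) (i : 'I_m) (a : op_car m),
    linear (op_comp h i a);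
  op_comp1l : forall n (h : n.+1 = (1 + n)%N) (i : 'I_1) (a : op_car n),
    op_comp h i op_id a = a;
  op_comp1r : forall n (h : n.+1 = (n + 1)%N) (i : 'I_n) (a : op_car n),
    op_comp h i a op_id = a;
  op_comp_seq : forall l m n p q r (h1 : p.+1 = (l + m)%N) (h2 : q.+1 = (p + n)%N)
      (h3 : r.+1 = (m + n)%N) (h4 : q.+1 = (l + r)%N)
      (i : 'I_l) (j : 'I_m) (ij : 'I_p)
      (a : op_car l) (b : op_car m) (c : op_car n),
    ij = (i + j)%N :> nat ->
    op_comp h2 ij (op_comp h1 i a b) c = op_comp h4 i a (op_comp h3 j b c);
  op_comp_par : forall l m n p q r (h1 : p.+1 = (l + m)%N) (h2 : q.+1 = (p + n)%N)
      (h3 : r.+1 = (l + n)%N) (h4 : q.+1 = (r + m)%N)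
      (i j : 'I_l) (j' : 'I_p) (i' : 'I_r)
      (a : op_car l) (b : op_car m) (c : op_car n),
    (i < j)%N -> j' = outer i m j :> nat -> i' = i :> nat ->
    op_comp h2 j' (op_comp h1 i a b) c = op_comp h4 i' (op_comp h3 j a c) b;
  op_comp_act : forall m n p (h : p.+1 = (m + n)%N) (i : 'I_m)
      (s : 'S_m) (t : 'S_n) (rho : 'S_p) (a : op_car m) (b : op_car n),
    comp_perm i s t rho ->
    op_comp h (s i) (op_act s a) (op_act t b) = op_act rho (op_comp h i a b)
}.

Arguments op_id {k o}.
Arguments op_act {k o n} s a.
Arguments op_comp {k o m n p} h i a b.

Definition operad_iso (k : fieldType) (O O' : operad k) : Prop :=
  exists f : forall n, O n -> O' n,
    [/\ forall n, linear (@f n),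
        forall n, bijective (@f n),
        f 1%N op_id = op_id,
        forall n (s : 'S_n) (a : O n), f n (op_act s a) = op_act s (f n a)
      & forall m n p (h : p.+1 = (m + n)%N) (i : 'I_m) (a : O m) (b : O n),
          f p (op_comp h i a b) = op_comp h i (f m a) (f n b)].

Record operadic_ideal (k : fieldType) (O : operad k) := OperadicIdeal {
  ideal_sub :> forall n, submodule (O n);
  ideal_act : forall n (s : 'S_n) (a : O n),
    ideal_sub n a -> ideal_sub n (op_act s a);
  ideal_compl : forall m n p (h : p.+1 = (m + n)%N) (i : 'I_m) (a : O m) (b : O n),
    ideal_sub m a -> ideal_sub p (op_comp h i a b);
  ideal_compr : forall m n p (h : p.+1 = (m + n)%N) (i : 'I_m) (a : O m) (b : O n),
    ideal_sub n b -> ideal_sub p (op_comp h i a b)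
}.

Inductive in_ideal (k : fieldType) (O : operad k) (d : nat) (G : O d -> Prop) :
  forall n, O n -> Prop :=
| In_ideal_gen a : G a -> in_ideal G a
| In_ideal0 n : in_ideal G (0 : O n)
| In_idealD n (a b : O n) : in_ideal G a -> in_ideal G b -> in_ideal G (a + b)
| In_idealZ n c (a : O n) : in_ideal G a -> in_ideal G (c *: a)
| In_ideal_act n (s : 'S_n) (a : O n) : in_ideal G a -> in_ideal G (op_act s a)
| In_ideal_compl m n p (h : p.+1 = (m + n)%N) (i : 'I_m) (a : O m) (b : O n) :
    in_ideal G a -> in_ideal G (op_comp h i a b)
| In_ideal_compr m n p (h : p.+1 = (m + n)%N) (i : 'I_m) (a : O m) (b : O n) :
    in_ideal G b -> in_ideal G (op_comp h i a b).

Definition ideal_gen (k : fieldType) (O : operad k) (d : nat) (G : O d -> Prop) :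
    operadic_ideal O :=
  OperadicIdeal
    (ideal_sub := fun n => Submodule (In_ideal0 G n) (@In_idealD _ _ _ G n)
                                     (@In_idealZ _ _ _ G n))
    (@In_ideal_act _ _ _ G) (@In_ideal_compl _ _ _ G) (@In_ideal_compr _ _ _ G).

Section QuotientOperad.
Variables (k : fieldType) (O : operad k) (I : operadic_ideal O).

Definition qop_car (n : nat) : lmodType k := quot_mod (I n).

Definition qop_proj n (a : O n) : qop_car n := quot_proj (I n) a.

Definition qop_id : qop_car 1 := qop_proj op_id.

Definition qop_act n (s : 'S_n) (a : qop_car n) : qop_car n :=
  qop_proj (op_act s (quot_repr a)).

Definition qop_comp m n p (h : p.+1 = (m + n)%N) (i : 'I_m)
    (a : qop_car m) (b : qop_car n) : qop_car p :=
  qop_proj (op_comp h i (quot_repr a) (quot_repr b)).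

Lemma linB (U V : lmodType k) (f : U -> V) : linear f ->
  forall u v, f (u - v) = f u - f v.
Proof.
by move=> lf u v; rewrite addrC -scaleN1r lf scaleN1r addrC.
Qed.

Lemma qop_projP n (a b : O n) : qop_proj a = qop_proj b <-> I n (a - b).
Proof. exact: quot_projP. Qed.

Lemma qop_ind n (P : qop_car n -> Prop) :
  (forall a, P (qop_proj a)) -> forall a, P a.
Proof. exact: quot_ind. Qed.

Lemma qop_proj_linear n : linear (@qop_proj n).
Proof. exact: quot_proj_linear. Qed.

Lemma qop_actE n (s : 'S_n) (a : O n) :
  qop_act s (qop_proj a) = qop_proj (op_act s a).
Proof.
apply/qop_projP; rewrite -(linB (op_act_linear s)).
exact/ideal_act/quot_reprP.
Qed.

Lemma qop_compE m n p (h : p.+1 = (m + n)%N) (i : 'I_m) (a : O m) (b : O n) :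
  qop_comp h i (qop_proj a) (qop_proj b) = qop_proj (op_comp h i a b).
Proof.
apply/qop_projP; rewrite -(subrKA (op_comp h i a (quot_repr (qop_proj b)))).
apply: in_subD.
  rewrite -(linB (op_compl_linear h i _)).
  exact/ideal_compl/quot_reprP.
rewrite -(linB (op_compr_linear h i _)).
exact/ideal_compr/quot_reprP.
Qed.

Lemma qop_reduced (a : qop_car 0) : a = 0.
Proof.
elim/qop_ind: a => a; rewrite (op_reduced a) -(subrr 0).
by rewrite (linB (@qop_proj_linear 0)) subrr.
Qed.

Lemma qop_act_linear n (s : 'S_n) : linear (qop_act s).
Proof.
move=> c; elim/qop_ind=> a; elim/qop_ind=> b.
by rewrite !qop_actE -!qop_proj_linear qop_actE op_act_linear.
Qed.

Lemma qop_act1 n (a : qop_car n) : qop_act 1%g a = a.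
Proof. by elim/qop_ind: a => a; rewrite qop_actE op_act1. Qed.

Lemma qop_actM n (s t : 'S_n) (a : qop_car n) :
  qop_act (s * t)%g a = qop_act t (qop_act s a).
Proof. by elim/qop_ind: a => a; rewrite !qop_actE op_actM. Qed.

Lemma qop_compl_linear m n p (h : p.+1 = (m + n)%N) (i : 'I_m) (b : qop_car n) :
  linear (fun a => qop_comp h i a b).
Proof.
move=> c; elim/qop_ind=> a; elim/qop_ind=> a'; elim/qop_ind: b => b.
by rewrite !qop_compE -!qop_proj_linear qop_compE op_compl_linear.
Qed.

Lemma qop_compr_linear m n p (h : p.+1 = (m + n)%N) (i : 'I_m) (a : qop_car m) :
  linear (qop_comp h i a).
Proof.
move=> c; elim/qop_ind=> b; elim/qop_ind=> b'; elim/qop_ind: a => a.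
by rewrite !qop_compE -!qop_proj_linear qop_compE op_compr_linear.
Qed.

Definition quot_operad : operad k.
Proof.
apply: (@Operad k qop_car qop_id qop_act qop_comp qop_reduced
          qop_act_linear qop_act1 qop_actM qop_compl_linear qop_compr_linear).
- by move=> n h i; elim/qop_ind=> a; rewrite qop_compE op_comp1l.
- by move=> n h i; elim/qop_ind=> a; rewrite qop_compE op_comp1r.
- move=> l m n p q r h1 h2 h3 h4 i j ij.
  elim/qop_ind=> a; elim/qop_ind=> b; elim/qop_ind=> c Hij.
  by rewrite !qop_compE (op_comp_seq h1 h2 h3 h4 a b c Hij).
- move=> l m n p q r h1 h2 h3 h4 i j j' i'.
  elim/qop_ind=> a; elim/qop_ind=> b; elim/qop_ind=> c lt_ij Hj Hi.
  by rewrite !qop_compE (op_comp_par h1 h2 h3 h4 a b c lt_ij Hj Hi).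
- move=> m n p h i s t rho; elim/qop_ind=> a; elim/qop_ind=> b Hrho.
  by rewrite [in RHS]qop_compE !qop_actE qop_compE (op_comp_act h a b Hrho).
Defined.

End QuotientOperad.

Inductive ptree (X : Type) := Leaf of nat | Node of X & ptree X & ptree X.
Arguments Leaf {X} j.

Fixpoint leaves (X : Type) (t : ptree X) : seq nat :=
  match t with Leaf j => [:: j] | Node _ l r => leaves l ++ leaves r end.

Fixpoint ptree_code (X : Type) (t : ptree X) : GenTree.tree (nat + X) :=
  match t with
  | Leaf j => GenTree.Leaf (inl j)
  | Node x l r => GenTree.Node 0 [:: GenTree.Leaf (inr x); ptree_code l; ptree_code r]
  end.

Fixpoint ptree_decode (X : Type) (t : GenTree.tree (nat + X)) : option (ptree X) :=
  match t with
  | GenTree.Leaf (inl j) => Some (Leaf j)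
  | GenTree.Node 0 [:: GenTree.Leaf (inr x); l; r] =>
      if ptree_decode l is Some l' then
        if ptree_decode r is Some r' then Some (Node x l' r') else None
      else None
  | _ => None
  end.

Lemma ptree_codeK X : pcancel (@ptree_code X) (@ptree_decode X).
Proof. by elim=> //= x l -> r ->. Qed.

HB.instance Definition _ (X : choiceType) :=
  Choice.copy (ptree X) (pcan_type (@ptree_codeK X)).

Fixpoint relabel (X : Type) (f : nat -> nat) (t : ptree X) : ptree X :=
  match t with
  | Leaf j => Leaf (f j)
  | Node x l r => Node x (relabel f l) (relabel f r)
  end.

(* Grafts u, which has n leaves, at the leaf i of t. *)
Fixpoint graft (X : Type) (i n : nat) (t u : ptree X) : ptree X :=
  match t with
  | Leaf j => if j == i then relabel (addn i) u else Leaf (outer i n j)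
  | Node x l r => Node x (graft i n l u) (graft i n r u)
  end.

Definition perm_nat n (s : 'S_n) (j : nat) : nat :=
  if insub j is Some i then val (s i) else j.

Lemma perm_natE n (s : 'S_n) (i : 'I_n) : perm_nat s i = s i.
Proof. by rewrite /perm_nat valK. Qed.

Lemma perm_natO n (s : 'S_n) (j : nat) (jn : (j < n)%N) :
  perm_nat s j = s (Ordinal jn).
Proof. by rewrite -perm_natE. Qed.

(* Planar binary trees, with vertices decorated by X and leaves bijectively
   labelled by 0, ..., n - 1. *)
Definition ltree (X : Type) (n : nat) := {t : ptree X | perm_eq (leaves t) (iota 0 n)}.

HB.instance Definition _ (X : choiceType) n :=
  Choice.copy (ltree X n) {t : ptree X | perm_eq (leaves t) (iota 0 n)}.

Section PlanarTrees.
Variable X : Type.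
Implicit Types t u v : ptree X.

Lemma leaves_relabel f t : leaves (relabel f t) = map f (leaves t).
Proof. by elim: t => //= x l -> r ->; rewrite map_cat. Qed.

Lemma relabel_comp f g t : relabel f (relabel g t) = relabel (f \o g) t.
Proof. by elim: t => //= x l -> r ->. Qed.

Lemma eq_relabel f g t : {in leaves t, f =1 g} -> relabel f t = relabel g t.
Proof.
elim: t => [j|x l IHl r IHr] /= fg; first by rewrite fg ?mem_head.
by rewrite IHl ?IHr // => j jr; apply: fg; rewrite mem_cat jr ?orbT.
Qed.

Lemma relabel_id f t : {in leaves t, f =1 id} -> relabel f t = t.
Proof. by move=> /eq_relabel ->; elim: t => //= x l -> r ->. Qed.

Lemma leaves_graft i n t u : leaves (graft i n t u) =
  flatten [seq if j == i then map (addn i) (leaves u) else [:: outer i n j] | j <- leaves t].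
Proof.
elim: t => [j|x l IHl r IHr] /=; last by rewrite map_cat flatten_cat IHl IHr.
by rewrite cats0; case: ifP => //; rewrite leaves_relabel.
Qed.

Lemma graft_valid m n p (i : 'I_m) t u : p.+1 = (m + n)%N ->
  perm_eq (leaves t) (iota 0 m) -> perm_eq (leaves u) (iota 0 n) ->
  perm_eq (leaves (graft i n t u)) (iota 0 p).
Proof.
move=> h tm un; rewrite leaves_graft.
set F := fun j => _.
apply: (perm_trans (perm_flatten (perm_map F tm))).
have im := ltn_ord i.
have -> : iota 0 m = iota 0 i ++ (i : nat) :: iota i.+1 (m - i.+1).
  by rewrite -[(i : nat) :: _]/(iota (0 + i) (m - i.+1).+1) -iotaD; congr iota; lia.
have -> : iota 0 p = iota 0 i ++ iota i n ++ iota (i + n) (m - i.+1).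
  rewrite -[iota i n]/(iota (0 + i) n) -iotaD -iotaD; congr iota; lia.
rewrite map_cat flatten_cat /= /F eqxx.
have -> : flatten [seq F j | j <- iota 0 i] = iota 0 i.
  rewrite -[RHS]map_id -[RHS]flatten_seq1 -map_comp; congr flatten.
  apply/eq_in_map=> j; rewrite mem_iota /F /outer /= add0n => ji.
  by rewrite ltn_eqF // ji.
have -> : flatten [seq F j | j <- iota i.+1 (m - i.+1)] = iota (i + n) (m - i.+1).
  have -> : iota (i + n) (m - i.+1) = map (fun j => (j + n).-1) (iota i.+1 (m - i.+1)).
    apply/(@eq_from_nth _ 0); first by rewrite size_map !size_iota.
    move=> j; rewrite size_iota => jm.
    by rewrite (nth_map 0) ?size_iota // !nth_iota //; lia.
  rewrite -[RHS]flatten_seq1 -map_comp; congr flatten.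
  apply/eq_in_map=> j; rewrite mem_iota /F /outer /= => ji.
  by rewrite gtn_eqF ?ltnNge ?[(i <= j)%N]ltnW //; lia.
rewrite perm_cat2l perm_cat2r.
have -> : iota i n = map (addn i) (iota 0 n) by rewrite -iotaDl addn0.
exact: perm_map.
Qed.

Lemma ltree_lt n t j : perm_eq (leaves t) (iota 0 n) -> j \in leaves t -> (j < n)%N.
Proof. by move=> /perm_mem->; rewrite mem_iota. Qed.

Lemma relabel_valid n (s : 'S_n) t : perm_eq (leaves t) (iota 0 n) ->
  perm_eq (leaves (relabel (perm_nat s) t)) (iota 0 n).
Proof.
move=> tn; rewrite leaves_relabel; apply: (perm_trans (perm_map _ tn)).
rewrite -val_enum_ord -map_comp.
have -> : map (perm_nat s \o val) (enum 'I_n) = map val (map s (enum 'I_n)).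
  by rewrite -[RHS]map_comp; apply/eq_in_map => i _ /=; rewrite perm_natE.
apply: perm_map; apply: uniq_perm; rewrite ?(map_inj_uniq (@perm_inj _ s)) ?enum_uniq //.
move=> i; rewrite mem_enum; apply/mapP; exists ((s^-1)%g i); rewrite ?mem_enum //.
by rewrite permKV.
Qed.

Definition lrelabel n (s : 'S_n) (t : ltree X n) : ltree X n :=
  exist _ (relabel (perm_nat s) (val t)) (relabel_valid s (valP t)).

Definition lgraft m n p (h : p.+1 = (m + n)%N) (i : 'I_m)
    (t : ltree X m) (u : ltree X n) : ltree X p :=
  exist _ (graft i n (val t) (val u)) (graft_valid i h (valP t) (valP u)).

Definition lleaf : ltree X 1 := exist _ (Leaf 0) (perm_refl _).

Lemma ltree0 (t : ltree X 0) : False.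
Proof.
case: t => t /perm_size /=; suff: (0 < size (leaves t))%N by case: size.
by elim: t => //= x l IHl r _; rewrite size_cat ltn_addr.
Qed.

Lemma lrelabel1 n (t : ltree X n) : lrelabel 1%g t = t.
Proof.
apply/val_inj/relabel_id => j /(ltree_lt (valP t)) jn.
by rewrite (perm_natO _ jn) perm1.
Qed.

Lemma lrelabelM n (s u : 'S_n) (t : ltree X n) :
  lrelabel (s * u)%g t = lrelabel u (lrelabel s t).
Proof.
apply/val_inj; rewrite /= relabel_comp; apply/eq_relabel => j /(ltree_lt (valP t)) jn.
by rewrite /= !(perm_natO _ jn) perm_natE permM.
Qed.

Lemma lgraft1l n (h : n.+1 = (1 + n)%N) (i : 'I_1) (t : ltree X n) :
  lgraft h i lleaf t = t.
Proof. by apply/val_inj; rewrite /= ord1 eqxx; apply: relabel_id. Qed.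

Lemma lgraft1r n (h : n.+1 = (n + 1)%N) (i : 'I_n) (t : ltree X n) :
  lgraft h i t lleaf = t.
Proof.
apply/val_inj => /=; elim: (val t) => [j|x l IHl r IHr] /=; last by rewrite IHl IHr.
case: eqP => [->|ji]; rewrite ?addn0 // /outer; case: ifP => //; rewrite addn1 //.
Qed.

Lemma graft_relabel_addn i j n u v :
  graft (i + j) n (relabel (addn i) u) v = relabel (addn i) (graft j n u v).
Proof.
elim: u => [l|x l IHl r IHr] /=; last by rewrite IHl IHr.
rewrite eqn_add2l; case: eqP => [_|lj].
  rewrite relabel_comp; apply: eq_relabel => a _ /=; exact/esym/addnA.
by congr Leaf; rewrite /outer ltn_add2l; case: ltnP => // jl; lia.
Qed.

Lemma lgraft_seq l m n p q r (h1 : p.+1 = (l + m)%N) (h2 : q.+1 = (p + n)%N)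
    (h3 : r.+1 = (m + n)%N) (h4 : q.+1 = (l + r)%N)
    (i : 'I_l) (j : 'I_m) (ij : 'I_p)
    (a : ltree X l) (b : ltree X m) (c : ltree X n) :
  ij = (i + j)%N :> nat ->
  lgraft h2 ij (lgraft h1 i a b) c = lgraft h4 i a (lgraft h3 j b c).
Proof.
move=> Hij; apply/val_inj; rewrite /= Hij; have jm := ltn_ord j.
elim: (val a) => [o|x u IHu v IHv] /=; last by rewrite IHu IHv.
case: eqP => [_|oi]; first exact: graft_relabel_addn.
rewrite /= /outer; case: (ltnP o i) => oi' /=.
  by rewrite ltn_eqF ?ltn_addr //.
by rewrite gtn_eqF ?ltnNge; [congr Leaf; case: leqP => /=|]; lia.
Qed.

Lemma graft_relabel_out (f : nat -> nat) i n u v :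
  {in leaves u, forall o, f o != i} ->
  graft i n (relabel f u) v = relabel (outer i n \o f) u.
Proof.
elim: u => [o|x l IHl r IHr] /= H; first by rewrite (negPf (H _ (mem_head _ _))).
by rewrite IHl ?IHr // => o ol; apply: H; rewrite mem_cat ol ?orbT.
Qed.

Lemma lgraft_par l m n p q r (h1 : p.+1 = (l + m)%N) (h2 : q.+1 = (p + n)%N)
    (h3 : r.+1 = (l + n)%N) (h4 : q.+1 = (r + m)%N)
    (i j : 'I_l) (j' : 'I_p) (i' : 'I_r)
    (a : ltree X l) (b : ltree X m) (c : ltree X n) :
  (i < j)%N -> j' = outer i m j :> nat -> i' = i :> nat ->
  lgraft h2 j' (lgraft h1 i a b) c = lgraft h4 i' (lgraft h3 j a c) b.
Proof.
move=> ij Hj Hi; apply/val_inj; rewrite /= Hi Hj.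
have -> : outer i m j = (j + m).-1 by rewrite /outer ltnNge ltnW.
have bm := ltree_lt (valP b).
elim: (val a) => [o|x u IHu v IHv] /=; last by rewrite IHu IHv.
have [->|/eqP oi] := eqVneq o i.
  rewrite (ltn_eqF ij) /= /outer ij eqxx.
  rewrite graft_relabel_out => [|y yb]; last by have := bm _ yb; lia.
  by apply: eq_relabel => y yb /=; rewrite /outer; have := bm _ yb; case: ifP; lia.
have [->|/eqP oj] := eqVneq o j.
  rewrite /= /outer ltnNge (ltnW ij) /= eqxx.
  rewrite graft_relabel_out => [|y yb]; last by lia.
  by apply: eq_relabel => y yb /=; rewrite /outer; case: ifP; lia.
rewrite /= /outer.
case: (ltnP o i) => oi'; case: (ltnP o j) => oj' /=; first [lia|idtac];
  by do 2! [case: eqP => [|_]; first lia]; congr Leaf; do ![case: ifP]; lia.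
Qed.

Lemma lgraft_relabel m n p (h : p.+1 = (m + n)%N) (i : 'I_m)
    (s : 'S_m) (t : 'S_n) (rho : 'S_p) (a : ltree X m) (b : ltree X n) :
  comp_perm i s t rho ->
  lgraft h (s i) (lrelabel s a) (lrelabel t b) = lrelabel rho (lgraft h i a b).
Proof.
case: a b => a am [b bn] [Hout Hin]; apply/val_inj => /=.
have im := ltn_ord i; move/ltree_lt: am; move/ltree_lt: bn => {}bn am.
elim: a am => [o|x u IHu v IHv] am /=; last first.
  by rewrite IHu ?IHv // => o ou; apply: am; rewrite /= mem_cat ou ?orbT.
have om : (o < m)%N by apply: am; rewrite mem_head.
rewrite (perm_natO _ om) -[X in if X then _ else _]/(s (Ordinal om) == s i) (inj_eq perm_inj).
rewrite -[o == i]/(Ordinal om == i); case: eqVneq => oi.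
  rewrite !relabel_comp; apply: eq_relabel => y /bn yn /=.
  have yp : (i + y < p)%N by lia.
  by rewrite (perm_natO _ yn) (perm_natO _ yp) (Hin (Ordinal yn)).
have op : (outer i n o < p)%N.
  move: oi; rewrite -val_eqE /outer /=; case: ifP; lia.
by rewrite /= (perm_natO _ op) (Hout _ (Ordinal op) oi).
Qed.

End PlanarTrees.

Section FreeModule.
Variables (k : fieldType) (K : choiceType) (V : lmodType k).

Lemma fgliftE (f : K -> V) (D : {freeg K / k}) :
  fglift f D = \sum_(z <- dom D) coeff z D *: f z.
Proof. by rewrite -{1}(Freeg_dom D) fglift_Freeg /prelift big_map. Qed.

Lemma fglift_linear (f : K -> V) : linear (fglift f).
Proof.
pose F : {additive {freeg K / k} -> V} :=
  HB.pack (fglift f) (GRing.isAdditive.Build {freeg K / k} V (fglift f) (lift_is_additive f)).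
move=> c D E; rewrite -[fglift f]/(F : _ -> _) raddfD; congr (_ + _).
rewrite [c *: D]/(fgscale c D) raddf_sum /= fgliftE scaler_sumr.
by apply: eq_bigr => z _; rewrite liftU scalerA.
Qed.

Lemma freegUZ (c : k) (z : K) : << c *g z >> = c *: << z >> :> {freeg K / k}.
Proof. by apply/eqP/freeg_eqP => x; rewrite coeffZ !coeffU mul1r. Qed.

Lemma linear_fglift (f : {freeg K / k} -> V) : linear f ->
  f =1 fglift (fun z => f << z >>).
Proof.
move=> lf D; pose F : {linear {freeg K / k} -> V} :=
  HB.pack f (GRing.isLinear.Build k {freeg K / k} V *:%R f lf).
rewrite fgliftE -{1}(freeg_sumE D) -[f]/(F : _ -> _) raddf_sum /=.
by apply: eq_bigr => z _; rewrite freegUZ; apply: (linearZ_LR F).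
Qed.

Lemma eq_fglift (f g : K -> V) : f =1 g -> fglift f =1 fglift g.
Proof. by move=> fg D; rewrite !fgliftE; apply: eq_bigr => z _; rewrite fg. Qed.

Lemma linear_ext (f g : {freeg K / k} -> V) : linear f -> linear g ->
  (forall z, f << z >> = g << z >>) -> f =1 g.
Proof.
by move=> lf lg fg D; rewrite (linear_fglift lf) (linear_fglift lg); apply: eq_fglift.
Qed.

Lemma fgliftU (f : K -> V) z : fglift f << z >> = f z.
Proof. by rewrite liftU scale1r. Qed.

Lemma fglift_linearr (U : lmodType k) (f : K -> U -> V) : (forall z, linear (f z)) ->
  forall D, linear (fun u => fglift (f^~ u) D).
Proof.
move=> lf D c u v; rewrite !fgliftE scaler_sumr -big_split /=.
by apply: eq_bigr => z _; rewrite lf scalerDr !scalerA mulrC.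
Qed.

End FreeModule.

(* The free reduced operad on the set X of binary operations, without
   symmetry: planar binary trees decorated by X, with labelled leaves. *)
Section PlanarTreeOperad.
Variables (k : fieldType) (X : choiceType).

Definition pt_car (n : nat) : lmodType k := {freeg (ltree X n) / k}.

Definition pt_id : pt_car 1 := << lleaf X >>.

Definition pt_act n (s : 'S_n) : pt_car n -> pt_car n :=
  fglift (fun t : ltree X n => << lrelabel s t >> : pt_car n).

Definition pt_comp m n p (h : p.+1 = (m + n)%N) (i : 'I_m)
    (a : pt_car m) (b : pt_car n) : pt_car p :=
  fglift (fun t : ltree X m =>
    fglift (fun u : ltree X n => << lgraft h i t u >> : pt_car p) b) a.

Lemma pt_act_linear n (s : 'S_n) : linear (pt_act s).
Proof. exact: fglift_linear. Qed.

Lemma pt_compl_linear m n p (h : p.+1 = (m + n)%N) (i : 'I_m) (b : pt_car n) :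
  linear (fun a => pt_comp h i a b).
Proof. exact: fglift_linear. Qed.

Lemma pt_compr_linear m n p (h : p.+1 = (m + n)%N) (i : 'I_m) (a : pt_car m) :
  linear (pt_comp h i a).
Proof. by apply: fglift_linearr => t; apply: fglift_linear. Qed.

Lemma pt_actU n (s : 'S_n) (t : ltree X n) : pt_act s << t >> = << lrelabel s t >>.
Proof. exact: fgliftU. Qed.

Lemma pt_compU m n p (h : p.+1 = (m + n)%N) (i : 'I_m) (t : ltree X m) (u : ltree X n) :
  pt_comp h i << t >> << u >> = << lgraft h i t u >>.
Proof. by rewrite /pt_comp !fgliftU. Qed.

Lemma linear_comp (U V W : lmodType k) (f : V -> W) (g : U -> V) :
  linear f -> linear g -> linear (fun u => f (g u)).
Proof. by move=> lf lg c u v; rewrite lg lf. Qed.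

Lemma linear_idfun (U : lmodType k) : linear (fun u : U => u).
Proof. by []. Qed.

Definition ptree_operad : operad k.
Proof.
apply: (@Operad k pt_car pt_id pt_act pt_comp _ pt_act_linear _ _
          pt_compl_linear pt_compr_linear).
- move=> a; rewrite -(freeg_sumE a); apply: big1 => t; by case: (ltree0 t).
- move=> n; apply: linear_ext; [exact: pt_act_linear|exact: linear_idfun|].
  by move=> t; rewrite pt_actU lrelabel1.
- move=> n s t; apply: linear_ext; first exact: pt_act_linear.
    exact: linear_comp (pt_act_linear _) (pt_act_linear _).
  by move=> u; rewrite !pt_actU lrelabelM.
- move=> n h i; apply: linear_ext; [exact: pt_compr_linear|exact: linear_idfun|].
  by move=> t; rewrite pt_compU lgraft1l.
- move=> n h i; apply: linear_ext.
    exact: (pt_compl_linear h i pt_id).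
    exact: linear_idfun.
  by move=> t; rewrite pt_compU lgraft1r.
- move=> l m n p q r h1 h2 h3 h4 i j ij a b c Hij.
  move: a; apply: linear_ext.
    exact: linear_comp (pt_compl_linear h2 ij c) (pt_compl_linear h1 i b).
    exact: pt_compl_linear.
  move=> t; move: b; apply: linear_ext.
    exact: linear_comp (pt_compl_linear h2 ij c) (pt_compr_linear h1 i _).
    exact: linear_comp (pt_compr_linear h4 i _) (pt_compl_linear h3 j c).
  move=> u; move: c; apply: linear_ext.
    exact: pt_compr_linear.
    exact: linear_comp (pt_compr_linear h4 i _) (pt_compr_linear h3 j _).
  by move=> v; rewrite !pt_compU (lgraft_seq h1 h2 h3 h4 t u v Hij).
- move=> l m n p q r h1 h2 h3 h4 i j j' i' a b c lt_ij Hj Hi.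
  move: a; apply: linear_ext.
    exact: linear_comp (pt_compl_linear h2 j' c) (pt_compl_linear h1 i b).
    exact: linear_comp (pt_compl_linear h4 i' b) (pt_compl_linear h3 j c).
  move=> t; move: b; apply: linear_ext.
    exact: linear_comp (pt_compl_linear h2 j' c) (pt_compr_linear h1 i _).
    exact: pt_compr_linear.
  move=> u; move: c; apply: linear_ext.
    exact: pt_compr_linear.
    exact: linear_comp (pt_compl_linear h4 i' _) (pt_compr_linear h3 j _).
  by move=> v; rewrite !pt_compU (lgraft_par h1 h2 h3 h4 t u v lt_ij Hj Hi).
- move=> m n p h i s t rho a b Hrho.
  move: a; apply: linear_ext.
    exact: linear_comp (pt_compl_linear h (s i) _) (pt_act_linear s).
    exact: linear_comp (pt_act_linear rho) (pt_compl_linear h i b).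
  move=> u; move: b; apply: linear_ext.
    exact: linear_comp (pt_compr_linear h (s i) _) (pt_act_linear t).
    exact: linear_comp (pt_act_linear rho) (pt_compr_linear h i _).
  by move=> v; rewrite !pt_actU !pt_compU pt_actU (lgraft_relabel h u v Hrho).
Defined.

End PlanarTreeOperad.

(* A finite dimensional S_2-module with a chosen basis [gens]; the
   transposition sends the basis element x to \sum_y flip x y *: y. *)
Record smod2 (k : fieldType) := SMod2 {
  gens :> finType;
  flip : gens -> gens -> k;
  flipK : forall x z, \sum_y flip x y * flip y z = (x == z)%:R
}.

Section FreeOperad.
Variables (k : fieldType) (M : smod2 k).

Definition corolla (x : M) : ptree_operad k M 2 :=
  << (exist _ (Node x (Leaf 0) (Leaf 1)) (perm_refl _) : ltree M 2) >>.

Definition symmetry_rel (a : ptree_operad k M 2) : Prop :=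
  exists x : M,
    a = op_act (tperm ord0 ord_max) (corolla x) - \sum_y flip x y *: corolla y.

(* T(M): decorated trees modulo the identifications coming from the action
   of S_2 on M. *)
Definition free_operad : operad k := quot_operad (ideal_gen symmetry_rel).

(* ((i, x), y) stands for the left comb (x; y)_{abc}, with upper vertex x and
   root y, where (a, b, c) is the cyclic permutation of the inputs 0, 1, 2
   starting at i. *)
Definition comb3 : finType := ('I_3 * M * M)%type.

Definition comb_tree (b : comb3) : ptree M :=
  let: (i, x, y) := b in
  Node y (Node x (Leaf i) (Leaf ((i + 1) %% 3)%N)) (Leaf ((i + 2) %% 3)%N).

Lemma comb_tree_valid b : perm_eq (leaves (comb_tree b)) (iota 0 3).
Proof. by case: b => [[[[|[|[|i]]] //= ?] x] y]. Qed.

Definition lcomb (b : comb3) : free_operad 3 :=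
  qop_proj _ (<< (exist _ (comb_tree b) (comb_tree_valid b) : ltree M 3) >>
              : ptree_operad k M 3).

(* The left combs form a basis of T(M)(3); [combs] is the resulting
   isomorphism. *)
Definition combs (alpha : {ffun comb3 -> k^o}) : free_operad 3 :=
  \sum_b alpha b *: lcomb b.

End FreeOperad.

Inductive symspan (k : fieldType) (O : operad k) (n : nat) (G : O n -> Prop) :
  O n -> Prop :=
| Symspan_gen a : G a -> symspan G a
| Symspan0 : symspan G 0
| SymspanD a b : symspan G a -> symspan G b -> symspan G (a + b)
| SymspanZ c a : symspan G a -> symspan G (c *: a)
| Symspan_act (s : 'S_n) a : symspan G a -> symspan G (op_act s a).

(* A presentation T(M)/<R> of a finitely generated binary quadratic operad. *)
Record quadratic (k : fieldType) := Quadratic {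
  q_mod :> smod2 k;
  q_rel : free_operad q_mod 3 -> Prop
}.

Definition quadratic_operad (k : fieldType) (P : quadratic k) : operad k :=
  quot_operad (ideal_gen (@q_rel k P)).

(* The sub-S_3-module of T(M)(3) generated by R. *)
Definition q_relmod (k : fieldType) (P : quadratic k) : free_operad P 3 -> Prop :=
  symspan (@q_rel k P).

Section Standard.
Variable k : fieldType.

Lemma scalar_flipK (e : k) : e * e = 1 ->
  forall x z : unit, \sum_(y : unit) e * e = (x == z)%:R.
Proof. by move=> ee [] []; rewrite ee (big_pred1 tt) //; case. Qed.

Definition sgn_smod2 : smod2 k :=
  SMod2 (gens := unit) (flip := fun _ _ => -1)
    (scalar_flipK (etrans (mulrNN 1 1) (mul1r 1))).

Definition triv_smod2 : smod2 k :=
  SMod2 (gens := unit) (flip := fun _ _ => 1) (scalar_flipK (mul1r 1)).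

Definition Lie : quadratic k :=
  Quadratic (q_mod := sgn_smod2) (fun r => r = \sum_(i < 3) lcomb ((i, tt, tt) : comb3 sgn_smod2)).

Definition Com : quadratic k :=
  Quadratic (q_mod := triv_smod2)
    (fun r => exists i j : 'I_3, 
      r = lcomb ((i, tt, tt) : comb3 triv_smod2) - lcomb ((j, tt, tt) : comb3 triv_smod2)).

End Standard.

Section Compatible.
Variables (k : fieldType) (Omega : finType).

Lemma copies_flipK (M : smod2 k) (x z : Omega * M) :
  \sum_(y : Omega * M) ((x.1 == y.1)%:R * flip x.2 y.2) *
                       ((y.1 == z.1)%:R * flip y.2 z.2) = (x == z)%:R.
Proof.
case: x z => [o x] [o' z]; rewrite xpair_eqE /= -mulnb natrM -flipK mulr_sumr.
rewrite -(pair_bigA _ (fun o1 y => ((o == o1)%:R * flip x y) *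
                                   ((o1 == o')%:R * flip y z))) /= (bigD1 o) //= [X in _ + X]big1 ?addr0.
  by apply: eq_bigr => y _; rewrite eqxx mul1r mulrCA.
move=> o1 ne; apply: big1 => y _; rewrite eq_sym (negPf ne).
by rewrite !mul0r.
Qed.

(* \bigoplus_omega M_omega, where x_omega is the pair (omega, x). *)
Definition copies (M : smod2 k) : smod2 k :=
  SMod2 (gens := (Omega * M)%type)
    (flip := fun x y => (x.1 == y.1)%:R * flip x.2 y.2) (@copies_flipK M).

(* w = (label of the upper vertex, label of the root). *)
Definition colored (M : smod2 k) (b : comb3 M) (w : Omega * Omega) :
    free_operad (copies M) 3 :=
  let: (i, x, y) := b in lcomb ((i, (w.1, x), (w.2, y)) : comb3 (copies M)).

Definition is_C2 (c : {ffun Omega -> nat}) : bool := (\sum_omega c omega == 2)%N.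

Definition in_Col (c : {ffun Omega -> nat}) (w : Omega * Omega) : bool :=
  [forall omega, ((w.1 == omega) + (w.2 == omega))%N == c omega].

Variable P : quadratic k.

(* Here and below alpha gives the coefficients of r = combs alpha in R, that is,
   r is written in the basis of the decorated trees that are left combs. *)
Definition LC_rel (r : free_operad (copies P) 3) : Prop :=
  exists (alpha : {ffun comb3 P -> k^o}) (c : {ffun Omega -> nat}),
    [/\ q_rel (combs alpha), is_C2 c
      & r = \sum_b alpha b *: \sum_(w | in_Col c w) colored b w].

Definition LC : quadratic k := Quadratic LC_rel.

(* The leveled matching compatibility. *)
Definition MT_rel (r : free_operad (copies P) 3) : Prop :=
  exists (alpha : {ffun comb3 P -> k^o}) (mu nu : Omega),
    q_rel (combs alpha) /\ r = \sum_b alpha b *: colored b (nu, mu).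

Definition TC_rel (r : free_operad (copies P) 3) : Prop :=
  exists (alpha : {ffun comb3 P -> k^o}) (b : comb3 P) (c : {ffun Omega -> nat})
      (delta tau : Omega * Omega),
    [/\ q_rel (combs alpha) /\ alpha b != 0, is_C2 c,
        in_Col c delta, in_Col c tau
      & r = colored b delta - colored b tau].

Definition TC : quadratic k := Quadratic (fun r => MT_rel r \/ TC_rel r).

End Compatible.

(* The decorated trees occurring in the elements of R generate T(M)(3) as an
   S_3-module.  R_TC only constrains the trees that occur in R, whereas the
   white product with Com^TC identifies, for every tree t and all labels mu, nu,
   the two colorings of t by mu and nu.  So, if Omega has at least two elements,
   this condition is necessary for P^TC to be that product: it fails, for
   instance, for a free operad (R = 0, M != 0). *)
Definition trees_of_rel_generate (k : fieldType) (P : quadratic k) : Prop :=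
  forall a : free_operad P 3,
    symspan (fun t : free_operad P 3 =>
      exists (alpha : {ffun comb3 P -> k^o}) (b : comb3 P),
        [/\ q_rel (combs alpha), alpha b != 0 & t = lcomb b]) a.

Section ManinProducts.
Variable k : fieldType.

Section Modules.
Variables (M N : smod2 k).

Lemma tensor_flipK (x z : M * N) :
  \sum_(y : M * N) (flip x.1 y.1 * flip x.2 y.2) * (flip y.1 z.1 * flip y.2 z.2)
  = (x == z)%:R.
Proof.
case: x z => [x x'] [z z']; rewrite xpair_eqE /= -mulnb natrM -!flipK.
rewrite -(pair_bigA _ (fun y y' => (flip x y * flip x' y') *
                                   (flip y z * flip y' z'))) /= mulr_suml.
apply: eq_bigr => y _.
by rewrite mulr_sumr; apply: eq_bigr => y' _; rewrite mulrACA.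
Qed.

Lemma tensor_sgn_flipK (x z : M * N) :
  \sum_(y : M * N) (- (flip x.1 y.1 * flip x.2 y.2)) *
                   (- (flip y.1 z.1 * flip y.2 z.2)) = (x == z)%:R.
Proof. by rewrite -tensor_flipK; apply: eq_bigr => y _; rewrite mulrNN. Qed.

(* M \otimes N *)
Definition tensor : smod2 k :=
  SMod2 (gens := (M * N)%type)
    (flip := fun x y => flip x.1 y.1 * flip x.2 y.2) tensor_flipK.

(* M \otimes N \otimes sgn_2 *)
Definition tensor_sgn : smod2 k :=
  SMod2 (gens := (M * N)%type)
    (flip := fun x y => - (flip x.1 y.1 * flip x.2 y.2)) tensor_sgn_flipK.

(* T(M)(3) \otimes T(N)(3), in the basis of pairs of left combs. *)
Definition tensor3 : lmodType k := {ffun comb3 M * comb3 N -> k^o}.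

Definition tens (alpha : {ffun comb3 M -> k^o}) (beta : {ffun comb3 N -> k^o}) :
    tensor3 :=
  [ffun b => alpha b.1 * beta b.2].

Definition Phi (gamma : {ffun comb3 tensor -> k^o}) : tensor3 :=
  [ffun b => let: ((i, x, y), (j, x', y')) := b in
     if i == j then gamma (i, (x, x'), (y, y')) else 0].

Definition Psi (tau : tensor3) : {ffun comb3 tensor_sgn -> k^o} :=
  [ffun b => let: (i, (x, x'), (y, y')) := b in tau ((i, x, y), (i, x', y'))].

End Modules.

Variables (P Q : quadratic k).

Definition white_tensor (t : tensor3 P Q) : Prop :=
  exists alpha beta, t = tens alpha beta /\
    (q_relmod (combs alpha) \/ q_relmod (combs beta)).

Definition white : quadratic k :=
  Quadratic (q_mod := tensor P Q) (fun r =>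
    exists gamma, lspan white_tensor (Phi gamma) /\ r = combs gamma).

Definition black : quadratic k :=
  Quadratic (q_mod := tensor_sgn P Q) (fun r =>
    exists alpha beta, [/\ q_relmod (combs alpha), q_relmod (combs beta)
                         & r = combs (Psi (tens alpha beta))]).

End ManinProducts.

(* Main.v *)
Require Import Defs.
From mathcomp Require Import all_boot all_order all_algebra all_fingroup.
From mathcomp Require Import boolp ring_quotient freeg zify.

(* In each case the generators on both sides are the copies x_omega of the
   generators of P, and this bijection respects the S_2-actions, so the two free
   operads agree and only the relations in arity 3 have to be compared.  Left
   combs form a basis of T(M)(3), and for every w in Omega^2 coloring the upper
   vertex and the root by w is an S_3-equivariant map K_w from T(M)(3) to
   T(copies of M)(3); an element of T(copies of M)(3) is a sum of K_w g_w.

   LC: the vectors J_c, the sums over w in Col(c) of K_w(Jacobi), span the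
   relations of Lie^LC, because permutations act on each J_c by a scalar.  The
   black product of J_c with r is the sum of K_w r over w in Col(c), which is r_c.

   TC: the relations of Com^TC are killed by the pairings p_c that sum the
   coordinates of all trees colored by c.  Hence gamma = \sum_w K_w g_w is a
   relation of the white product only if, for every c, the sum of g_w over w in
   Col(c) is a relation of P.  Modulo the relations of P^TC, K_w depends only on
   the multiset of labels of w (as the trees of R generate T(M)(3) if Omega has
   two elements), and K_w r = 0 for r in R, so gamma vanishes. *)

Set Implicit Arguments.
Unset Strict Implicit.
Unset Printing Implicit Defensive.

Import GRing.Theory.
Local Open Scope ring_scope.

(** * Linear maps, operad morphisms and their descent to quotients *)

Section LinearMaps.
Variables (k : fieldType) (U V : lmodType k) (f : U -> V).
Hypothesis lf : linear f.

Lemma lin0 : f 0 = 0.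
Proof. by rewrite -(subrr 0) (linB lf) subrr. Qed.

Lemma linD u v : f (u + v) = f u + f v.
Proof. by rewrite -[u]scale1r lf !scale1r. Qed.

Lemma linZ c u : f (c *: u) = c *: f u.
Proof. by rewrite -[c *: u]addr0 lf lin0 addr0. Qed.

Lemma lin_sum (I : Type) (r : seq I) (P : pred I) (F : I -> U) :
  f (\sum_(i <- r | P i) F i) = \sum_(i <- r | P i) f (F i).
Proof. exact: (big_morph f linD lin0). Qed.

End LinearMaps.

Lemma in_sub_sum (k : fieldType) (V : lmodType k) (W : submodule V)
    (I : Type) (r : seq I) (P : pred I) (F : I -> V) :
  (forall i, P i -> W (F i)) -> W (\sum_(i <- r | P i) F i).
Proof.
move=> WF; elim/big_ind: _ => //; first exact: in_sub0.
by move=> u v; apply: in_subD.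
Qed.

Section OperadMorphisms.
Variable k : fieldType.

Definition operad_hom (O O' : operad k) (f : forall n, O n -> O' n) : Prop :=
  [/\ forall n, linear (@f n),
      f 1%N op_id = op_id,
      forall n (s : 'S_n) (a : O n), f n (op_act s a) = op_act s (f n a)
    & forall m n p (h : p.+1 = (m + n)%N) (i : 'I_m) (a : O m) (b : O n),
        f p (op_comp h i a b) = op_comp h i (f m a) (f n b)].

(** The preimage of an operadic ideal under a morphism is again closed under all the operations that
    generate an ideal, so only the generators need checking. *)
Lemma hom_ideal_gen (O O' : operad k) (f : forall n, O n -> O' n)
    (d : nat) (G : O d -> Prop) (I : operadic_ideal O') :
  operad_hom f -> (forall a, G a -> I d (f d a)) ->
  forall n (a : O n), ideal_gen G n a -> I n (f n a).
Proof.
move=> [fl _ fact fcomp] GI n a; elim=> {n a}.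
- exact: GI.
- by move=> n; rewrite (lin0 (fl n)); apply: in_sub0.
- by move=> n a b _ Ia _ Ib; rewrite (linD (fl n)); apply: in_subD.
- by move=> n c a _ Ia; rewrite (linZ (fl n)); apply: in_subZ.
- by move=> n s a _ Ia; rewrite fact; apply: ideal_act.
- by move=> m n p h i a b _ Ia; rewrite fcomp; apply: ideal_compl.
- by move=> m n p h i a b _ Ib; rewrite fcomp; apply: ideal_compr.
Qed.

Section QuotientMap.
Variables (O O' : operad k) (f : forall n, O n -> O' n).
Variables (I : operadic_ideal O) (I' : operadic_ideal O').

(** Evaluation at a chosen representative makes this total for every f; independence of the choice
    is [qmapE], once f sends I into I'. *)
Definition qmap n (a : quot_operad I n) : quot_operad I' n :=
  qop_proj I' (f (quot_repr (a : qop_car I n))).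

Hypothesis f_hom : operad_hom f.
Hypothesis fI : forall n (a : O n), I n a -> I' n (f a).

Lemma qmapE n (a : O n) : qmap (qop_proj I a) = qop_proj I' (f a).
Proof.
case: f_hom => fl _ _ _; apply/qop_projP; rewrite -(linB (fl n)).
exact/fI/quot_reprP.
Qed.

Lemma qmap_hom : operad_hom qmap.
Proof.
case: (f_hom) => fl fid fact fcomp; split.
- move=> n c; elim/qop_ind=> a; elim/qop_ind=> b.
  by rewrite -qop_proj_linear !qmapE fl qop_proj_linear.
- by rewrite /= /qop_id qmapE fid.
- by move=> n s; elim/qop_ind=> a; rewrite /= qop_actE !qmapE fact qop_actE.
- move=> m n p h i; elim/qop_ind=> a; elim/qop_ind=> b.
  by rewrite /= qop_compE !qmapE fcomp qop_compE.
Qed.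

End QuotientMap.

Lemma qmapK (O O' : operad k) (f : forall n, O n -> O' n) (g : forall n, O' n -> O n)
    (I : operadic_ideal O) (I' : operadic_ideal O') :
  operad_hom f -> operad_hom g ->
  (forall n (a : O n), I n a -> I' n (f n a)) ->
  (forall n (a : O' n), I' n a -> I n (g n a)) ->
  (forall n, cancel (f n) (g n)) ->
  forall n, cancel (@qmap O O' f I I' n) (@qmap O' O g I' I n).
Proof.
by move=> fh gh fI gI fK n; elim/qop_ind=> a; rewrite !qmapE // fK.
Qed.

Lemma operad_iso_of_inverse (O O' : operad k)
    (f : forall n, O n -> O' n) (g : forall n, O' n -> O n) :
  operad_hom f -> (forall n, cancel (f n) (g n)) -> (forall n, cancel (g n) (f n)) ->
  operad_iso O O'.
Proof.
by case=> fl fid fact fcomp fK gK; exists f; split=> // n; exists (g n).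
Qed.

End OperadMorphisms.

(** * Isomorphisms induced by bijections of generators *)

Fixpoint ptree_map (X Y : Type) (phi : X -> Y) (t : ptree X) : ptree Y :=
  match t with
  | Leaf j => Leaf j
  | Node x l r => Node (phi x) (ptree_map phi l) (ptree_map phi r)
  end.

Section TreeMap.
Variables (X Y : Type) (phi : X -> Y).

Lemma leaves_map t : leaves (ptree_map phi t) = leaves t.
Proof. by elim: t => //= x l -> r ->. Qed.

Lemma map_relabel f t : ptree_map phi (relabel f t) = relabel f (ptree_map phi t).
Proof. by elim: t => //= x l -> r ->. Qed.

Lemma map_graft i n t u :
  ptree_map phi (graft i n t u) = graft i n (ptree_map phi t) (ptree_map phi u).
Proof.
by elim: t => [j|x l IHl r IHr] /=; rewrite ?IHl ?IHr //; case: ifP; rewrite ?map_relabel.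
Qed.

Lemma ltree_map_valid n (t : ltree X n) :
  perm_eq (leaves (ptree_map phi (val t))) (iota 0 n).
Proof. by rewrite leaves_map (valP t). Qed.

Definition ltree_map n (t : ltree X n) : ltree Y n :=
  exist _ (ptree_map phi (val t)) (ltree_map_valid t).

End TreeMap.

Lemma ptree_mapK (X Y : Type) (phi : X -> Y) (psi : Y -> X) :
  cancel phi psi -> cancel (ptree_map phi) (ptree_map psi).
Proof. by move=> phiK; elim=> //= x l -> r ->; rewrite phiK. Qed.

Section PlanarMap.
Variables (k : fieldType) (X Y : choiceType) (phi : X -> Y).

Definition planar_map n (a : ptree_operad k X n) : ptree_operad k Y n :=
  fglift (fun t : ltree X n => << ltree_map phi t >> : pt_car k Y n) a.

Lemma planar_mapU n (t : ltree X n) :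
  planar_map (<< t >> : pt_car k X n) = << ltree_map phi t >>.
Proof. exact: fgliftU. Qed.

Lemma planar_map_linear n : linear (@planar_map n).
Proof. exact: fglift_linear. Qed.

Lemma planar_map_hom : operad_hom planar_map.
Proof.
split; first exact: planar_map_linear.
- by rewrite /= /pt_id planar_mapU; congr << _ >>; apply/val_inj.
- move=> n s; apply: linear_ext.
  + exact: linear_comp (@planar_map_linear n) (pt_act_linear s).
  + exact: linear_comp (pt_act_linear s) (@planar_map_linear n).
  move=> t; rewrite /= pt_actU !planar_mapU pt_actU; congr << _ >>.
  by apply/val_inj; rewrite /= map_relabel.
- move=> m n p h i a b; move: a; apply: linear_ext.
  + exact: linear_comp (@planar_map_linear p) (pt_compl_linear h i b).
  + exact: linear_comp (pt_compl_linear h i _) (@planar_map_linear m).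
  move=> t; move: b; apply: linear_ext.
  + exact: linear_comp (@planar_map_linear p) (pt_compr_linear h i _).
  + exact: linear_comp (pt_compr_linear h i _) (@planar_map_linear n).
  move=> u; rewrite /= pt_compU !planar_mapU pt_compU; congr << _ >>.
  by apply/val_inj; rewrite /= map_graft.
Qed.

End PlanarMap.

Lemma planar_mapK (k : fieldType) (X Y : choiceType) (phi : X -> Y) (psi : Y -> X) :
  cancel phi psi -> forall n, cancel (@planar_map k X Y phi n) (@planar_map k Y X psi n).
Proof.
move=> phiK n; apply: linear_ext.
- exact: linear_comp (@planar_map_linear k Y X psi n) (@planar_map_linear k X Y phi n).
- exact: linear_idfun.
move=> t; rewrite !planar_mapU; congr << _ >>.
by apply/val_inj; rewrite /= ptree_mapK.
Qed.

Section FreeMap.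
Variables (k : fieldType) (M N : smod2 k) (phi : M -> N) (psi : N -> M).
Hypotheses (phiK : cancel phi psi) (psiK : cancel psi phi).
Hypothesis phi_flip : forall x y, flip (phi x) (phi y) = flip x y.

Definition free_map : forall n, free_operad M n -> free_operad N n :=
  @qmap k (ptree_operad k M) (ptree_operad k N) (planar_map phi)
    (ideal_gen (@symmetry_rel k M)) (ideal_gen (@symmetry_rel k N)).

Lemma planar_map_corolla x :
  planar_map phi (corolla x : ptree_operad k M 2) = corolla (phi x).
Proof. by rewrite planar_mapU; congr << _ >>; apply/val_inj. Qed.

Lemma planar_map_ideal n (a : ptree_operad k M n) :
  ideal_gen (@symmetry_rel k M) n a ->
  ideal_gen (@symmetry_rel k N) n (planar_map phi a).
Proof.
apply: hom_ideal_gen (planar_map_hom k phi) _ n a => a [x ->].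
apply: In_ideal_gen; exists (phi x).
have lin := @planar_map_linear k M N phi 2; have [_ _ act _] := planar_map_hom k phi.
rewrite (linB lin) act planar_map_corolla (lin_sum lin); congr (_ - _).
rewrite (reindex phi) /=; last by exists psi => ? _.
by apply: eq_bigr => y _; rewrite (linZ lin) planar_map_corolla phi_flip.
Qed.

Lemma free_mapE n (a : ptree_operad k M n) :
  free_map (qop_proj _ a) = qop_proj _ (planar_map phi a).
Proof. by apply: qmapE; [exact: planar_map_hom|exact: planar_map_ideal]. Qed.

Lemma free_map_hom : operad_hom free_map.
Proof. by apply: qmap_hom; [exact: planar_map_hom|exact: planar_map_ideal]. Qed.

Definition comb_map (b : comb3 M) : comb3 N := let: (i, x, y) := b in (i, phi x, phi y).

Lemma free_map_lcomb b : free_map (lcomb b) = lcomb (comb_map b).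
Proof.
rewrite /lcomb free_mapE planar_mapU; congr (qop_proj _ _); congr << _ >>.
by apply/val_inj; case: b => [[i x] y].
Qed.

Lemma free_map_combs alpha :
  free_map (combs alpha) = \sum_b alpha b *: lcomb (comb_map b).
Proof.
have [lin _ _ _] := free_map_hom; rewrite /combs (lin_sum (lin 3)).
by apply: eq_bigr => b _; rewrite (linZ (lin 3)) free_map_lcomb.
Qed.

End FreeMap.

(** The equivariant bijection gives mutually inverse morphisms of free operads. Each sends the
    generating relations, hence the whole ideal, into the ideal on the other side, so both descend
    and stay inverse to each other. *)
Lemma quadratic_iso (k : fieldType) (P Q : quadratic k) (phi : P -> Q) (psi : Q -> P) :
  cancel phi psi -> cancel psi phi ->
  (forall x y, flip (phi x) (phi y) = flip x y) ->
  (forall r, q_rel r -> ideal_gen (@q_rel k Q) 3 (free_map phi r)) ->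
  (forall r, q_rel r -> ideal_gen (@q_rel k P) 3 (free_map psi r)) ->
  operad_iso (quadratic_operad P) (quadratic_operad Q).
Proof.
move=> phiK psiK phi_flip relP relQ.
have psi_flip x y : flip (psi x) (psi y) = flip x y by rewrite -phi_flip !psiK.
have phi_hom := free_map_hom phiK psiK phi_flip.
have psi_hom := free_map_hom psiK phiK psi_flip.
have phiI := hom_ideal_gen phi_hom relP; have psiI := hom_ideal_gen psi_hom relQ.
have phi_free := planar_map_ideal phiK psiK phi_flip.
have psi_free := planar_map_ideal psiK phiK psi_flip.
have FK n : cancel (@free_map k P Q phi n) (@free_map k Q P psi n).
  exact: (qmapK (planar_map_hom k phi) (planar_map_hom k psi) phi_free psi_free
                (planar_mapK phiK)).
have GK n : cancel (@free_map k Q P psi n) (@free_map k P Q phi n).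
  exact: (qmapK (planar_map_hom k psi) (planar_map_hom k phi) psi_free phi_free
                (planar_mapK psiK)).
apply: (operad_iso_of_inverse (qmap_hom phi_hom phiI)).
  exact: (qmapK phi_hom psi_hom phiI psiI FK).
exact: (qmapK psi_hom phi_hom psiI phiI GK).
Qed.

(** * One-hole contexts and the coordinates of arity 3 elements on left combs *)

Inductive tree_ctx (X : Type) :=
  Hole | CtxL of X & tree_ctx X & ptree X | CtxR of X & ptree X & tree_ctx X.
Arguments Hole {X}.

Section TreeContexts.
Variable X : Type.
Implicit Types (C D : tree_ctx X) (t u : ptree X).

Fixpoint plug C t : ptree X :=
  match C with
  | Hole => t
  | CtxL x C r => Node x (plug C t) r
  | CtxR x l C => Node x l (plug C t)
  end.

Fixpoint ctx_map (F : ptree X -> ptree X) C : tree_ctx X :=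
  match C with
  | Hole => Hole
  | CtxL x C r => CtxL x (ctx_map F C) (F r)
  | CtxR x l C => CtxR x (F l) (ctx_map F C)
  end.

Fixpoint ctx_comp C D : tree_ctx X :=
  match C with
  | Hole => D
  | CtxL x C r => CtxL x (ctx_comp C D) r
  | CtxR x l C => CtxR x l (ctx_comp C D)
  end.

Lemma plug_comp C D t : plug (ctx_comp C D) t = plug C (plug D t).
Proof. by elim: C => //= [x C -> //|x l C ->]. Qed.

Lemma relabel_plug f C t :
  relabel f (plug C t) = plug (ctx_map (relabel f) C) (relabel f t).
Proof. by elim: C => //= [x C -> //|x l C ->]. Qed.

Lemma graft_plug i n C t u :
  graft i n (plug C t) u = plug (ctx_map (fun v => graft i n v u) C) (graft i n t u).
Proof. by elim: C => //= [x C -> //|x l C ->]. Qed.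

Lemma graft_notin i n t u u' : i \notin leaves t -> graft i n t u = graft i n t u'.
Proof.
elim: t => [j|x l IHl r IHr] /=; first by rewrite inE eq_sym => /negPf ->.
by rewrite mem_cat negb_or => /andP[/IHl -> /IHr ->].
Qed.

(** The label i sits at a single leaf, so u enters the grafted tree only there. The other branches
    never see u, and the fixed tree [u0] can stand in for it in the context. *)
Lemma graft_ctx i n t u0 : uniq (leaves t) -> i \in leaves t ->
  exists C, forall u, graft i n t u = plug C (relabel (addn i) u).
Proof.
elim: t => [j|x l IHl r IHr] /=.
  by rewrite inE eq_sym => _ ij; exists Hole => u; rewrite /= ij.
rewrite cat_uniq mem_cat => /and3P[ul /hasPn lr ur] /orP[il|ir].
  have [C HC] := IHl ul il; exists (CtxL x C (graft i n r u0)) => u /=.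
  rewrite HC (graft_notin n u u0) //; apply/negP => /lr; by rewrite /= il.
have [C HC] := IHr ur ir; exists (CtxR x (graft i n l u0) C) => u /=.
by rewrite HC (graft_notin n u u0) //; apply: (lr i).
Qed.

End TreeContexts.

Lemma perm_nat_tperm2 : (perm_nat (tperm ord0 ord_max : 'S_2) 0 = 1%N) *
  (perm_nat (tperm ord0 ord_max : 'S_2) 1 = 0%N).
Proof.
split; [rewrite (perm_natO _ (isT : (0 < 2)%N))|rewrite (perm_natO _ (isT : (1 < 2)%N))].
  by rewrite (_ : Ordinal _ = ord0) ?tpermL //; apply/val_inj.
by rewrite (_ : Ordinal _ = ord_max) ?tpermR //; apply/val_inj.
Qed.

Section FreeArity3.
Variables (k : fieldType) (M : smod2 k).

(** The symmetry relation applied at an arbitrary vertex, whose position is the hole of C: this is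
    what f must satisfy to factor through the free operad. *)
Definition flip_compat (V : lmodType k) (f : ptree M -> V) : Prop :=
  forall C x l r,
    f (plug C (Node x l r)) = \sum_y flip x y *: f (plug C (Node y r l)).

(* The condition on f is stable under precomposition with relabelling and with
   grafting on either side, so induction on the generation of the ideal works. *)
Lemma flip_compat_ideal n (a : ptree_operad k M n) :
  ideal_gen (@symmetry_rel k M) n a ->
  forall (V : lmodType k) (f : ptree M -> V), flip_compat f ->
  fglift (fun t : ltree M n => f (val t)) a = 0.
Proof.
elim=> {n a} [a [x ->]|n|n a b _ IHa _ IHb|n c a _ IHa|n s a _ IHa
             |m n p h i a b _ IHa|m n p h i a b _ IHb] V f fC.
- have lin := fglift_linear (fun t : ltree M 2 => f (val t)).
  rewrite (linB lin) (lin_sum lin) /= pt_actU fgliftU.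
  rewrite (fC Hole).
  apply/eqP; rewrite subr_eq0; apply/eqP/eq_bigr => y _.
  by rewrite (linZ lin) fgliftU /= !perm_nat_tperm2.
- exact: (lin0 (fglift_linear _)).
- by rewrite (linD (fglift_linear _)) IHa // IHb // addr0.
- by rewrite (linZ (fglift_linear _)) IHa // scaler0.
- rewrite -(IHa V (fun t => f (relabel (perm_nat s) t))); last first.
    by move=> C x l r; rewrite relabel_plug fC; apply: eq_bigr => y _; rewrite relabel_plug.
  move: a {IHa}; apply: linear_ext.
  + exact: linear_comp (fglift_linear _) (pt_act_linear s).
  + exact: fglift_linear.
  by move=> t; rewrite /= pt_actU !fgliftU.
- move: b; apply: linear_ext.
  + exact: linear_comp (fglift_linear _) (pt_compr_linear h i a).
  + by move=> c u v; rewrite scaler0 addr0.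
  move=> u; rewrite -(IHa V (fun t => f (graft i n t (val u)))); last first.
    by move=> C x l r; rewrite graft_plug fC; apply: eq_bigr => y _; rewrite graft_plug.
  move: a {IHa}; apply: linear_ext.
  + exact: linear_comp (fglift_linear _) (pt_compl_linear h i _).
  + exact: fglift_linear.
  by move=> t; rewrite /= pt_compU !fgliftU.
move: a; apply: linear_ext.
- exact: linear_comp (fglift_linear _) (pt_compl_linear h i b).
- by move=> c u v; rewrite scaler0 addr0.
move=> t.
have ti : (i : nat) \in leaves (val t) by rewrite (perm_mem (valP t)) mem_iota /=.
have tu : uniq (leaves (val t)) by rewrite (perm_uniq (valP t)) iota_uniq.
have [C HC] := graft_ctx n (Leaf 0) tu ti.
rewrite -(IHb V (fun u => f (plug C (relabel (addn i) u)))); last first.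
  move=> D x l r; rewrite relabel_plug -plug_comp fC.
  by apply: eq_bigr => y _; rewrite relabel_plug plug_comp.
move: b {IHb}; apply: linear_ext.
- exact: linear_comp (fglift_linear _) (pt_compr_linear h i _).
- exact: fglift_linear.
by move=> u; rewrite /= pt_compU !fgliftU /= HC.
Qed.

Definition std3 (w : nat * nat * nat) (x y : M) : ptree M :=
  let: (a, b, c) := w in Node y (Node x (Leaf a) (Leaf b)) (Leaf c).

Definition cyc (i : nat) : nat * nat * nat := (i, (i + 1) %% 3, (i + 2) %% 3)%N.

Definition swap12 (w : nat * nat * nat) : nat * nat * nat :=
  let: (a, b, c) := w in (b, a, c).

(* The coordinates of the tree [std3 w x y] on the left combs: w is either a cyclic
   permutation of the inputs or becomes one after flipping the upper vertex. *)
Definition comb_coord (w : nat * nat * nat) (x y : M) : {ffun comb3 M -> k^o} :=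
  [ffun d : comb3 M =>
     ((w == cyc d.1.1)%:R * (x == d.1.2)%:R +
      (swap12 w == cyc d.1.1)%:R * flip x d.1.2) * (y == d.2)%:R : k].

(** A tree with three leaves is a left comb, or becomes one after a flip at the root. Flips preserve
    the set of all other shapes, so the default 0 on them is compatible with flips. *)
Definition tree_coord (t : ptree M) : {ffun comb3 M -> k^o} :=
  match t with
  | Node y (Node x (Leaf a) (Leaf b)) (Leaf c) => comb_coord (a, b, c) x y
  | Node y (Leaf c) (Node x (Leaf a) (Leaf b)) =>
      \sum_z flip y z *: comb_coord (a, b, c) x z
  | _ => 0
  end.

(** The two sides are orderings of the inputs of opposite parity. *)
Lemma cyc_swap i j : (i < 3)%N -> (j < 3)%N -> cyc i <> swap12 (cyc j).
Proof. by move: i j => [|[|[|i]]] [|[|[|j]]]. Qed.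

Lemma swap12K : involutive swap12. Proof. by move=> [[a b] c]. Qed.

Lemma sum_flipK (V : lmodType k) (x : M) (F : M -> V) :
  \sum_y flip x y *: (\sum_z flip y z *: F z) = F x.
Proof.
under eq_bigr => y _ do rewrite scaler_sumr.
rewrite exchange_big /= (bigD1 x) //= [X in _ + X]big1 ?addr0 => [|z zx].
  under eq_bigr => y _ do rewrite scalerA.
  by rewrite -scaler_suml flipK eqxx scale1r.
under eq_bigr => y _ do rewrite scalerA.
by rewrite -scaler_suml flipK eq_sym (negPf zx) scale0r.
Qed.

Lemma sum_pred1 (V : lmodType k) (F : M -> V) z : \sum_y (y == z)%:R *: F y = F z.
Proof.
rewrite (bigD1 z) //= eqxx scale1r big1 ?addr0 // => y /negPf ->.
by rewrite scale0r.
Qed.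

Lemma comb_coord_swap w x y :
  comb_coord w x y = \sum_z flip x z *: comb_coord (swap12 w) z y.
Proof.
apply/ffunP => -[[i x'] y']; rewrite sum_ffunE ffunE /=.
(* Both coefficients become sums over z: the Kronecker delta by [flipK], and the entry [flip x x']
   by inserting a delta. The two summands then match those on the right in the opposite order. *)
rewrite -flipK -(sum_pred1 (fun z => flip x z : k^o)) !mulr_sumr -big_split mulr_suml.
apply: eq_bigr => z _ /=; rewrite !ffunE /= swap12K.
rewrite [RHS](mulrC (flip x z)) !mulrDl [RHS]addrC -!mulrA.
congr (_ + _); congr (_ * _).
  by rewrite [RHS]mulrC -mulrA [RHS]mulrC -mulrA.
by congr (_ * _); rewrite [RHS]mulrC.
Qed.

Lemma plug_node C (x : M) l r : exists y u v, plug C (Node x l r) = Node y u v.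
Proof. by case: C => [|y C v|y u C] /=; do 3 eexists. Qed.

Lemma sum_scaler0 (V : lmodType k) (F : M -> k) : \sum_y F y *: (0 : V) = 0.
Proof. by rewrite big1 // => y _; rewrite scaler0. Qed.

(** By the depth of the flipped vertex: at the root the flip is undone by its own involutivity
    ([sum_flipK]), at a child of the root [comb_coord_swap] applies, and deeper down the tree has at
    least three vertices, so both sides vanish. *)
Lemma tree_coord_flip : flip_compat tree_coord.
Proof.
case=> [x l r|x C r y l r'|x l C y l' r] /=.
- case: l => [a|y [b|? ? ?] [c|? ? ?]]; case: r => [a'|y' [b'|? ? ?] [c'|? ? ?]] //=;
    by rewrite ?sum_scaler0 // sum_flipK.
- case: C => [|z C v|z v C] /=.
  + case: l r' r => [a|? ? ?] [b|? ? ?] [c|? ? ?] /=;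
      rewrite ?sum_scaler0 //; exact: comb_coord_swap.
  + have Z t u u' : tree_coord (Node x (Node z (plug C (Node t u u')) v) r) = 0.
      by have [? [? [? ->]]] := plug_node C t u u'; case: v r => [?|? ? ?] [?|? ? ?].
    by move: Z => /= Z; rewrite Z big1 // => t _; rewrite Z scaler0.
  + have Z t u u' : tree_coord (Node x (Node z v (plug C (Node t u u'))) r) = 0.
      by have [? [? [? ->]]] := plug_node C t u u'; case: v r => [?|? ? ?] [?|? ? ?].
    by move: Z => /= Z; rewrite Z big1 // => t _; rewrite Z scaler0.
- case: C => [|z C v|z v C] /=.
  + case: l l' r => [a|? [?|? ? ?] [?|? ? ?]] [b|? ? ?] [c|? ? ?] /=;
      rewrite ?sum_scaler0 //.
    under [in RHS]eq_bigr => t _ do rewrite scaler_sumr.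
    rewrite exchange_big /=; apply: eq_bigr => t _.
    rewrite comb_coord_swap scaler_sumr; apply: eq_bigr => t' _.
    by rewrite !scalerA mulrC.
  + have Z t u u' : tree_coord (Node x l (Node z (plug C (Node t u u')) v)) = 0.
      by have [? [? [? ->]]] := plug_node C t u u';
        case: v l => [?|? ? ?] [?|? [?|? ? ?] [?|? ? ?]].
    by move: Z => /= Z; rewrite Z big1 // => t _; rewrite Z scaler0.
  + have Z t u u' : tree_coord (Node x l (Node z v (plug C (Node t u u')))) = 0.
      by have [? [? [? ->]]] := plug_node C t u u';
        case: v l => [?|? ? ?] [?|? [?|? ? ?] [?|? ? ?]].
    by move: Z => /= Z; rewrite Z big1 // => t _; rewrite Z scaler0.
Qed.

Definition coords (a : free_operad M 3) : {ffun comb3 M -> k^o} :=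
  fglift (fun t : ltree M 3 => tree_coord (val t)) (quot_repr (a : qop_car _ 3)).

(** Two representatives differ by an element of the symmetry ideal, which [flip_compat_ideal] sends
    to 0. *)
Lemma coordsE (a : ptree_operad k M 3) :
  coords (qop_proj _ a) = fglift (fun t : ltree M 3 => tree_coord (val t)) a.
Proof.
apply/eqP; rewrite -subr_eq0 -(linB (fglift_linear _)); apply/eqP.
exact: flip_compat_ideal (quot_reprP _ _) _ _ tree_coord_flip.
Qed.

Lemma coords_linear : linear coords.
Proof.
move=> c; elim/qop_ind=> a; elim/qop_ind=> b.
by rewrite /= -qop_proj_linear !coordsE fglift_linear.
Qed.

Definition ffun1 (b : comb3 M) : {ffun comb3 M -> k^o} := [ffun d => (b == d)%:R].

Lemma comb_coord_cyc (i : 'I_3) x y : comb_coord (cyc i) x y = ffun1 (i, x, y).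
Proof.
apply/ffunP => -[[i' x'] y']; rewrite !ffunE /=.
have -> : (cyc i == cyc i') = (i == i') by apply/eqP/eqP => [[/val_inj]|->].
have -> : (swap12 (cyc i) == cyc i') = false.
  by apply/eqP => /esym; apply: cyc_swap.
by rewrite mul0r addr0 -!natrM !mulnb !xpair_eqE.
Qed.

Lemma coords_lcomb b : coords (lcomb b) = ffun1 b.
Proof.
by rewrite /lcomb coordsE fgliftU; case: b => [[i x] y]; rewrite -comb_coord_cyc.
Qed.

Lemma ffun_sum1 (alpha : {ffun comb3 M -> k^o}) : alpha = \sum_b alpha b *: ffun1 b.
Proof.
apply/ffunP => d; rewrite sum_ffunE (bigD1 d) //= big1 => [|b bd].
  by rewrite !ffunE eqxx addr0 -[_ *: _]/(_ * _) mulr1.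
by rewrite !ffunE (negPf bd) scaler0.
Qed.

(** This is the linear independence of the left combs. *)
Lemma combsK : cancel (@combs k M) coords.
Proof.
move=> alpha; rewrite [RHS]ffun_sum1 /combs (lin_sum coords_linear).
by apply: eq_bigr => b _; rewrite (linZ coords_linear) coords_lcomb.
Qed.

Lemma combs_linear : linear (@combs k M).
Proof.
move=> c al be; rewrite /combs scaler_sumr -big_split; apply: eq_bigr => b _ /=.
by rewrite !ffunE scalerDl scalerA.
Qed.

Lemma combs_ffun1 b : combs (ffun1 b) = lcomb b.
Proof.
rewrite /combs (bigD1 b) //= big1 => [|d /negPf bd]; first by rewrite ffunE eqxx scale1r addr0.
by rewrite ffunE eq_sym bd scale0r.
Qed.

End FreeArity3.

(** * Left combs span arity 3, and the action of S_3 on them *)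

Section TreeClasses.
Variables (k : fieldType) (M : smod2 k).

(** Taking a bare tree, with default 0 when its labels are invalid, allows rewriting inside t
    without carrying a proof of validity. *)
Definition tree_class n (t : ptree M) : free_operad M n :=
  if insub t is Some t' then
    qop_proj _ (<< (t' : ltree M n) >> : ptree_operad k M n) else 0.

Lemma tree_classE n (t : ltree M n) :
  tree_class n (val t) = qop_proj _ (<< t >> : ptree_operad k M n).
Proof. by rewrite /tree_class valK. Qed.

Lemma act_tree_class n (s : 'S_n) t : perm_eq (leaves t) (iota 0 n) ->
  op_act s (tree_class n t) = tree_class n (relabel (perm_nat s) t).
Proof.
move=> tn; rewrite -[t]/(val (exist _ t tn : ltree M n)) tree_classE /= qop_actE.
by rewrite /= pt_actU -tree_classE.
Qed.

Definition relabel3 (s : 'S_3) (w : nat * nat * nat) : nat * nat * nat :=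
  let: (a, b, c) := w in (perm_nat s a, perm_nat s b, perm_nat s c).

Lemma relabel_std3 s w (x y : M) :
  relabel (perm_nat s) (std3 w x y) = std3 (relabel3 s w) x y.
Proof. by case: w => [[a b] c]. Qed.

Lemma ideal_sum_flip n (g : ptree_operad k M 2 -> ptree_operad k M n) a (x : M)
    (F : M -> ptree_operad k M 2) :
  linear g -> ideal_gen (@symmetry_rel k M) n (g (a - \sum_y flip x y *: F y)) ->
  qop_proj _ (g a) = \sum_y flip x y *: (qop_proj _ (g (F y)) : free_operad M n).
Proof.
move=> lg; rewrite (linB lg) => /qop_projP ->.
have lin := @qop_proj_linear k _ (ideal_gen (@symmetry_rel k M)) n.
rewrite (lin_sum lg) (lin_sum lin); apply: eq_bigr => y _.
by rewrite (linZ lg) (linZ lin).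
Qed.

Lemma symmetry_corolla (x : M) : ideal_gen (@symmetry_rel k M) 2
  (op_act (tperm ord0 ord_max) (corolla x) - \sum_y flip x y *: corolla y).
Proof. by apply: In_ideal_gen; exists x. Qed.

Let h3 : (3.+1 = 2 + 2)%N := erefl.

(** The symmetry relation of x, grafted at the first input of the corolla of y. *)
Lemma tree_class_swap x y :
  tree_class 3 (std3 (1, 0, 2)%N x y) =
  \sum_z flip x z *: tree_class 3 (std3 (0, 1, 2)%N z y).
Proof.
pose F z : ptree_operad k M 3 := op_comp h3 ord0 (corolla y) (corolla z).
have FE z : tree_class 3 (std3 (0, 1, 2)%N z y) = qop_proj _ (F z).
  by rewrite /F /= pt_compU -tree_classE.
under eq_bigr => z _ do rewrite FE.
have := ideal_compr h3 ord0 (corolla y) (symmetry_corolla x).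
have lin := op_compr_linear h3 ord0 (corolla y).
move/(ideal_sum_flip lin) => <-; rewrite /= pt_actU pt_compU -tree_classE.
by congr tree_class; rewrite /= !perm_nat_tperm2.
Qed.

(** The symmetry relation of y, with the corolla of x grafted at the input 0; the transposition has
    moved this input to the right of the root. *)
Lemma tree_class_rswap x y :
  tree_class 3 (Node y (Leaf 2) (Node x (Leaf 0) (Leaf 1))) =
  \sum_z flip y z *: tree_class 3 (std3 (0, 1, 2)%N x z).
Proof.
pose F z : ptree_operad k M 3 := op_comp h3 ord0 (corolla z) (corolla x).
have FE z : tree_class 3 (std3 (0, 1, 2)%N x z) = qop_proj _ (F z).
  by rewrite /F /= pt_compU -tree_classE.
under eq_bigr => z _ do rewrite FE.
have := ideal_compl h3 ord0 (corolla x) (symmetry_corolla y).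
have lin := op_compl_linear h3 ord0 (corolla x).
move/(ideal_sum_flip lin) => <-; rewrite /= pt_actU pt_compU -tree_classE.
by congr tree_class; rewrite /= !perm_nat_tperm2.
Qed.

Lemma perm3P (a b c : nat) : perm_eq [:: a; b; c] (iota 0 3) ->
  exists s : 'S_3, (a, b, c) = relabel3 s (0, 1, 2)%N.
Proof.
move=> /(@tuple_permP _ _ _ [tuple 0; 1; 2]%N)[s /= E].
have {E} E i (i3 : (i < 3)%N) : nth 0%N [:: a; b; c] i = perm_nat s i.
  rewrite E (perm_natO _ i3).
  rewrite (nth_map (Ordinal i3)) ?size_enum_ord // (_ : nth _ _ _ = Ordinal i3); last first.
    by apply/val_inj; exact: nth_enum_ord.
  by case: (s _) => -[|[|[|j]]].
by exists s; rewrite /= -!E.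
Qed.

Lemma act_std3 (s : 'S_3) x y : op_act s (tree_class 3 (std3 (0, 1, 2)%N x y)) =
  tree_class 3 (std3 (relabel3 s (0, 1, 2)%N) x y).
Proof. by rewrite act_tree_class // relabel_std3. Qed.

Lemma tree_class_swapE (s : 'S_3) x y :
  tree_class 3 (std3 (swap12 (relabel3 s (0, 1, 2)%N)) x y) =
  \sum_z flip x z *: tree_class 3 (std3 (relabel3 s (0, 1, 2)%N) z y).
Proof.
under eq_bigr => z _ do rewrite -act_std3 -(linZ (op_act_linear s)).
rewrite -(lin_sum (op_act_linear s)) -tree_class_swap act_tree_class //.
Qed.

Lemma tree_class_rswapE (s : 'S_3) x y :
  tree_class 3 (Node y (Leaf (perm_nat s 2))
                  (Node x (Leaf (perm_nat s 0)) (Leaf (perm_nat s 1)))) =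
  \sum_z flip y z *: tree_class 3 (std3 (relabel3 s (0, 1, 2)%N) x z).
Proof.
under eq_bigr => z _ do rewrite -act_std3 -(linZ (op_act_linear s)).
rewrite -(lin_sum (op_act_linear s)) -tree_class_rswap act_tree_class //.
Qed.

End TreeClasses.

(** Even permutations keep the cyclic orderings of the inputs cyclic; odd ones turn them into cyclic
    orderings with the first two entries exchanged. *)
Lemma cyc_or_swap (s : 'S_3) : exists e (j : 'I_3 -> 'I_3), injective j /\
  forall i : 'I_3, relabel3 s (cyc i) = (if e then id else swap12) (cyc (j i)).
Proof.
have perm_lt i : (i < 3)%N -> (perm_nat s i < 3)%N.
  by move=> i3; rewrite (perm_natO _ i3) ltn_ord.
have perm_neq i j : (i < 3)%N -> (j < 3)%N -> i != j -> perm_nat s i != perm_nat s j.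
  move=> i3 j3 ij; rewrite (perm_natO _ i3) (perm_natO _ j3) val_eqE (inj_eq perm_inj).
  by rewrite -val_eqE.
(* The boolean e says that s is even. For odd s the exchange puts the image of the second entry
   first, so j uses the successor of i modulo 3. *)
pose e := (perm_nat s 1 == (perm_nat s 0 + 1) %% 3)%N.
pose j (i : 'I_3) := s (if e then i else inord ((i + 1) %% 3)).
exists e, j; split.
  move=> i i' /perm_inj; case: (e) => // /(congr1 val); rewrite /= !inordK ?ltn_pmod //.
  by case: i i' => -[|[|[|i]]] // ? [[|[|[|i']]] //= ?] _; apply/val_inj.
have jE i : val (j i) = if e then perm_nat s i else perm_nat s ((i + 1) %% 3).
  by rewrite -[LHS]perm_natE; case: (e); rewrite // inordK ?ltn_pmod.
move=> i; rewrite /cyc !jE /e; clear jE j e.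
have := perm_lt 0 isT; have := perm_lt 1 isT; have := perm_lt 2 isT.
have := perm_neq 0 1 isT isT isT; have := perm_neq 0 2 isT isT isT.
have := perm_neq 1 2 isT isT isT.
have m3 := (erefl : (0 + 1) %% 3 = 1, erefl : (0 + 2) %% 3 = 2,
  erefl : (1 + 1) %% 3 = 2, erefl : (1 + 2) %% 3 = 0,
  erefl : (2 + 1) %% 3 = 0, erefl : (2 + 2) %% 3 = 1)%N.
case: i => -[|[|[|i]]] //= _; rewrite !m3;
  move: (perm_nat s 0) (perm_nat s 1) (perm_nat s 2).
all: by do 3! [case=> [|[|[|?]]] //].
Qed.

Section CombBasis.
Variables (k : fieldType) (M : smod2 k).

Lemma lcomb_class i (x y : M) : lcomb (i, x, y) = tree_class 3 (std3 (cyc i) x y).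
Proof. by rewrite /lcomb -tree_classE. Qed.

Lemma tree_class_swap_cyc (i : 'I_3) (x y : M) :
  tree_class 3 (std3 (swap12 (cyc i)) x y) = \sum_z flip x z *: lcomb (i, z, y).
Proof.
have [|s E] := @perm3P i ((i + 1) %% 3)%N ((i + 2) %% 3)%N.
  by case: i => -[|[|[|i]]].
under eq_bigr => z _ do rewrite lcomb_class.
by rewrite /cyc E tree_class_swapE.
Qed.

(** For even s the tree is itself a left comb; for odd s it is one with its upper vertex flipped,
    and both sides expand along [flip x]. *)
Lemma combs_comb_coord (s : 'S_3) (x y : M) :
  combs (comb_coord (relabel3 s (0, 1, 2)%N) x y) =
  tree_class 3 (std3 (relabel3 s (0, 1, 2)%N) x y).
Proof.
have [e [j [_ /(_ ord0)]]] := cyc_or_swap s; rewrite -[cyc ord0]/(0, 1, 2)%N => ->.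
case: e; first by rewrite comb_coord_cyc combs_ffun1 lcomb_class.
rewrite comb_coord_swap swap12K tree_class_swap_cyc (lin_sum (@combs_linear k M)).
by apply: eq_bigr => z _; rewrite (linZ (@combs_linear k M)) comb_coord_cyc combs_ffun1.
Qed.

(** Three leaves leave two shapes, according to the side of the root that carries the single leaf.
    If it is the left one, a flip at the root reduces to the other shape. *)
Lemma combs_tree_coord (t : ltree M 3) :
  combs (tree_coord (val t)) = tree_class 3 (val t).
Proof.
have size_gt0 (u : ptree M) : (0 < size (leaves u))%N.
  by elim: u => //= x l IHl r _; rewrite size_cat ltn_addr.
have size1 (u : ptree M) : size (leaves u) = 1%N -> exists a, u = Leaf a.
  case: u => [a|x l r] /=; first by exists a.
  by rewrite size_cat; have := size_gt0 l; have := size_gt0 r; lia.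
have size2 (u : ptree M) : size (leaves u) = 2%N ->
    exists x a b, u = Node x (Leaf a) (Leaf b).
  case: u => [a|x l r] //=; rewrite size_cat => H.
  have := size_gt0 l; have := size_gt0 r => r0 l0.
  have [|a ->] := size1 l; first by lia.
  have [|b ->] := size1 r; first by lia.
  by exists x, a, b.
case: t => [[a|y l r] tv] /=; first by have := perm_size tv.
have := perm_size tv; rewrite /= size_cat => H.
have := size_gt0 l; have := size_gt0 r => r0 l0.
have [l1|l2] : size (leaves l) = 1%N \/ size (leaves l) = 2%N by lia.
  have [c lE] := size1 l l1; have [|x [a [b rE]]] := size2 r; first by lia.
  move: tv; rewrite lE rE /= => tv.
  have [|s [-> -> ->]] := @perm3P a b c; first by rewrite (perm_catC [:: a; b] [:: c]).
  rewrite tree_class_rswapE (lin_sum (@combs_linear k M)); apply: eq_bigr => z _.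
  by rewrite (linZ (@combs_linear k M)) -combs_comb_coord.
have [x [a [b lE]]] := size2 l l2; have [|c rE] := size1 r; first by lia.
move: tv; rewrite lE rE /= => tv.
by have [s E] := perm3P tv; rewrite E combs_comb_coord -E.
Qed.

(** This is the spanning half of the basis property, checked on classes of trees. *)
Lemma coordsK : cancel (@coords k M) (@combs k M).
Proof.
elim/qop_ind=> a.
have lproj := @qop_proj_linear k _ (ideal_gen (@symmetry_rel k M)) 3.
have lin := linear_comp (@combs_linear k M) (linear_comp (@coords_linear k M) lproj).
apply: (linear_ext lin lproj) => t.
by rewrite coordsE fgliftU combs_tree_coord tree_classE.
Qed.

End CombBasis.

(** Here e and j are chosen before M: the same pair serves for M and for its copies, which makes the
    two actions comparable in [color_act]. *)
Lemma act_lcomb (k : fieldType) (s : 'S_3) :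
  exists e (j : 'I_3 -> 'I_3), injective j /\
  forall (M : smod2 k) i (x y : M), op_act s (lcomb (i, x, y)) =
    if e then lcomb (j i, x, y) else \sum_z flip x z *: lcomb (j i, z, y).
Proof.
have [e [j [j_inj H]]] := cyc_or_swap s; exists e, j; split=> // M i x y.
rewrite lcomb_class act_tree_class ?relabel_std3 ?H; last exact: (comb_tree_valid (i, x, y)).
by case: e {H} => /=; rewrite ?lcomb_class // tree_class_swap_cyc.
Qed.

Lemma linear_combE (k : fieldType) (M : smod2 k) (V : lmodType k)
    (f : free_operad M 3 -> V) (a : free_operad M 3) :
  linear f -> f a = \sum_b coords a b *: f (lcomb b).
Proof.
move=> lf; rewrite -{1}(coordsK a) /combs (lin_sum lf).
by apply: eq_bigr => b _; rewrite (linZ lf).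
Qed.

Lemma linear_comb_ext (k : fieldType) (M : smod2 k) (V : lmodType k)
    (f g : free_operad M 3 -> V) :
  linear f -> linear g -> (forall b, f (lcomb b) = g (lcomb b)) -> f =1 g.
Proof.
move=> lf lg fg a; rewrite (linear_combE a lf) (linear_combE a lg).
by apply: eq_bigr => b _; rewrite fg.
Qed.

Lemma symspan_ideal (k : fieldType) (O O' : operad k) n (G : O n -> Prop)
    (I : operadic_ideal O') (f : O n -> O' n) :
  linear f -> (forall (s : 'S_n) a, f (op_act s a) = op_act s (f a)) ->
  (forall a, G a -> I n (f a)) -> forall a, symspan G a -> I n (f a).
Proof.
move=> lf fact GI a; elim=> {a} [a /GI //||a b _ Ia _ Ib|c a _ Ia|s a _ Ia].
- by rewrite (lin0 lf); apply: in_sub0.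
- by rewrite (linD lf); apply: in_subD.
- by rewrite (linZ lf); apply: in_subZ.
- by rewrite fact; apply: ideal_act.
Qed.

Lemma free_map_combsE (k : fieldType) (M N : smod2 k) (phi : M -> N) (psi : N -> M) :
  cancel phi psi -> cancel psi phi ->
  (forall x y, flip (phi x) (phi y) = flip x y) ->
  forall alpha : {ffun comb3 M -> k^o},
  free_map phi (combs alpha) = combs [ffun b => alpha (comb_map psi b)].
Proof.
move=> phiK psiK phi_flip alpha; rewrite (free_map_combs phiK psiK phi_flip).
rewrite /combs [RHS](reindex (@comb_map k M N phi)) /=.
  by apply: eq_bigr => -[[i x] y] _; rewrite ffunE /= !phiK.
by exists (@comb_map k N M psi) => -[[i x] y] _; rewrite /= ?phiK ?psiK.
Qed.

(** * The coloring maps and their equivariance *)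

Section Coloring.
Variables (k : fieldType) (Omega : finType).

Section Color.
Variable M : smod2 k.

Definition color_comb (w : Omega * Omega) (b : comb3 M) : comb3 (copies Omega M) :=
  let: (i, x, y) := b in (i, (w.1, x), (w.2, y)).

Lemma coloredE b w : colored b w = lcomb (color_comb w b).
Proof. by case: b => [[i x] y]. Qed.

(** This is the map K_w. *)
Definition color (w : Omega * Omega) (a : free_operad M 3) : free_operad (copies Omega M) 3 :=
  \sum_b coords a b *: colored b w.

Lemma color_linear w : linear (color w).
Proof.
move=> c a b; rewrite /color scaler_sumr -big_split; apply: eq_bigr => d _ /=.
by rewrite coords_linear !ffunE scalerDl scalerA.
Qed.

Lemma color_combs w alpha : color w (combs alpha) = \sum_b alpha b *: colored b w.
Proof. by rewrite /color combsK. Qed.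

Lemma color_lcomb w b : color w (lcomb b) = colored b w.
Proof.
rewrite /color coords_lcomb (bigD1 b) //= big1 => [|d /negPf bd].
  by rewrite ffunE eqxx scale1r addr0.
by rewrite ffunE eq_sym bd scale0r.
Qed.

(** A permutation moves the position of a left comb and possibly flips its upper vertex. Neither
    affects the labels, because the flip on the copies preserves each copy of M. *)
Lemma color_act w (s : 'S_3) a : color w (op_act s a) = op_act s (color w a).
Proof.
move: a; apply: linear_comb_ext.
- exact: linear_comp (color_linear w) (op_act_linear s).
- exact: linear_comp (op_act_linear s) (color_linear w).
have [e [j [_ H]]] := act_lcomb k s.
case=> [[i x] y]; rewrite color_lcomb coloredE H.
rewrite (H (copies Omega M) i (w.1, x) (w.2, y)).
case: e {H}; first by rewrite color_lcomb coloredE.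
rewrite (lin_sum (color_linear w)).
(* The sum over the copies is split into a label o and a basis element z; only o = w.1
   contributes. *)
transitivity (\sum_o \sum_z ((w.1 == o)%:R * flip x z) *:
    lcomb ((j i, (o, z), (w.2, y)) : comb3 (copies Omega M))); last first.
  by rewrite pair_bigA; apply: eq_bigr => -[].
rewrite [RHS](bigD1 w.1) //= [X in _ + X]big1 ?addr0 => [|o /negPf wo].
  by apply: eq_bigr => z _; rewrite eqxx mul1r (linZ (color_linear w)) color_lcomb coloredE.
by apply: big1 => z _; rewrite eq_sym wo mul0r scale0r.
Qed.

Lemma combs_colors (gamma : {ffun comb3 (copies Omega M) -> k^o}) :
  combs gamma = \sum_w color w (combs [ffun b => gamma (color_comb w b)]).
Proof.
under eq_bigr => w _ do rewrite color_combs.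
rewrite pair_bigA /= /combs.
rewrite (reindex (fun p : (Omega * Omega) * comb3 M => color_comb p.1 p.2)) /=.
  by apply: eq_bigr => -[w b] _; rewrite ffunE coloredE.
exists (fun d : comb3 (copies Omega M) =>
  ((d.1.2.1, d.2.1), (d.1.1, d.1.2.2, d.2.2))).
  by move=> [[o o'] [[i x] y]].
by move=> [[i [o x]] [o' y]].
Qed.

End Color.

(** The multiset of labels of w; its fibres are the sets Col(c). *)
Definition color_count (w : Omega * Omega) : {ffun Omega -> nat} :=
  [ffun o => ((w.1 == o) + (w.2 == o))%N].

Lemma in_ColE c w : in_Col c w = (color_count w == c).
Proof.
apply/forallP/eqP => [H|<- o]; last by rewrite ffunE.
by apply/ffunP => o; rewrite ffunE; apply/eqP/H.
Qed.

Lemma is_C2_count w : is_C2 (color_count w).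
Proof.
rewrite /is_C2; under eq_bigr => o _ do rewrite ffunE.
have sum1 (o : Omega) : (\sum_o' (o == o') = 1)%N.
  by rewrite (bigD1 o) //= eqxx big1 // => o' /negPf; rewrite eq_sym => ->.
by rewrite big_split /= !sum1.
Qed.

Section ScalarFlip.
Variables (M : smod2 k) (eps : k).
Hypothesis flip_scalar : forall x y : M, flip x y = (x == y)%:R * eps.

(** When S_2 acts by the scalar eps, a flip costs a factor eps and leaves the decorations alone.
    This covers Lie with eps = -1 and Com with eps = 1; in the latter case no factor appears. *)
Lemma act_lcomb_scalar (s : 'S_3) : exists c (j : 'I_3 -> 'I_3), injective j /\
  (eps = 1 -> c = 1) /\
  forall i (x y : M), op_act s (lcomb (i, x, y)) = c *: lcomb (j i, x, y).
Proof.
have [e [j [j_inj H]]] := act_lcomb k s.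
exists (if e then 1 else eps), j; split=> //; split; first by case: (e).
move=> i x y; rewrite H; case: e {H}; rewrite ?scale1r //.
rewrite (bigD1 x) //= flip_scalar eqxx mul1r big1 ?addr0 // => z /negPf xz.
by rewrite flip_scalar eq_sym xz mul0r scale0r.
Qed.

(** The permutation only moves the cyclic positions, up to a common scalar, and the coefficients do
    not depend on the position. *)
Lemma act_combs_scalar (s : 'S_3) (gamma : {ffun comb3 M -> k^o}) :
  (forall i j x y, gamma (i, x, y) = gamma (j, x, y)) ->
  exists e : k, op_act s (combs gamma) = e *: combs gamma.
Proof.
move=> gamma_cst; have [e [j [j_inj [_ H]]]] := act_lcomb_scalar s.
exists e; rewrite /combs (lin_sum (op_act_linear s)) scaler_sumr.
rewrite [RHS](reindex (fun b : comb3 M => (j b.1.1, b.1.2, b.2))).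
  apply: eq_bigr => -[[i x] y] _.
  by rewrite (linZ (op_act_linear s)) H !scalerA mulrC (gamma_cst i (j i)).
exists (fun b : comb3 M => (invF j_inj b.1.1, b.1.2, b.2)) => -[[i x] y] _ /=.
  by rewrite invF_f.
by rewrite f_invF.
Qed.

End ScalarFlip.

Lemma flip_copies_scalar (M : smod2 k) (eps : k) :
  (forall x y : M, flip x y = (x == y)%:R * eps) ->
  forall x y : copies Omega M, flip x y = (x == y)%:R * eps.
Proof.
move=> H [o x] [o' y]; rewrite /= H xpair_eqE mulrA -natrM mulnb //.
Qed.

End Coloring.

(** * Relations of Lie^LC and the black product *)

Section LieCompatible.
Variables (k : fieldType) (Omega : finType).
Let L : quadratic k := LC Omega (Lie k).

(** Coordinates of J_c: all combs have coefficient 1 in the Jacobi relation, so only the labels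
    matter. *)
Definition Col_coord (c : {ffun Omega -> nat}) : {ffun comb3 L -> k^o} :=
  [ffun b : comb3 L => (in_Col c (b.1.2.1, b.2.1))%:R : k].

Lemma combs_Col_coord c : combs (Col_coord c) =
  \sum_(w | in_Col c w) color w (combs [ffun=> 1] : free_operad (sgn_smod2 k) 3).
Proof.
rewrite combs_colors [RHS]big_mkcond; apply: eq_bigr => w _.
have -> : [ffun b => Col_coord c (color_comb w b)] =
          ((in_Col c w)%:R : k) *: ([ffun=> 1] : {ffun comb3 (sgn_smod2 k) -> k^o}).
  apply/ffunP => -[[i x] y]; rewrite !ffunE /= -surjective_pairing.
  by rewrite -[RHS]/(_ * 1) mulr1.
rewrite (linZ (@combs_linear k _)) (linZ (color_linear w)).
by case: ifP => _; rewrite ?scale1r ?scale0r.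
Qed.

Lemma Lie_relE : combs [ffun=> 1] = \sum_(i < 3) lcomb ((i, tt, tt) : comb3 (sgn_smod2 k)).
Proof.
rewrite /combs; under eq_bigr => b _ do rewrite ffunE scale1r.
rewrite [RHS](reindex (fun b : comb3 (sgn_smod2 k) => b.1.1)) /=.
  by apply: eq_bigr => -[[i []] []].
by exists (fun i : 'I_3 => (i, tt, tt)) => [[[i []] []]|i].
Qed.

Lemma LC_Lie_relP (r : free_operad L 3) :
  q_rel r <-> exists2 c, is_C2 c & r = combs (Col_coord c).
Proof.
split=> [[alpha [c [/= lie c2 ->]]]|[c c2 ->]].
  exists c => //; rewrite combs_Col_coord Lie_relE -lie.
  transitivity (\sum_(w | in_Col c w) \sum_b alpha b *: colored b w).
    by rewrite exchange_big; apply: eq_bigr => b _; rewrite scaler_sumr.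
  by apply: eq_bigr => w _; rewrite /color combsK.
exists [ffun=> 1], c; split=> //; first exact: Lie_relE.
rewrite combs_Col_coord; under eq_bigr => w _ do rewrite color_combs.
by rewrite exchange_big; apply: eq_bigr => b _; rewrite scaler_sumr.
Qed.

Lemma act_Col_coord (s : 'S_3) c :
  exists e : k, op_act s (combs (Col_coord c)) = e *: combs (Col_coord c).
Proof.
have flip_sgn (x y : sgn_smod2 k) : flip x y = (x == y)%:R * -1.
  by case: x y => [] [] /=; rewrite mul1r.
apply: (act_combs_scalar (@flip_copies_scalar k Omega _ _ flip_sgn)) => i j x y.
by rewrite !ffunE.
Qed.

Lemma LC_Lie_relmod (a : {ffun comb3 L -> k^o}) : q_relmod (combs a) ->
  lspan (fun v => exists2 c, is_C2 c & v = Col_coord c) a.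
Proof.
set S := lspan _; rewrite -{2}(combsK a).
elim: {a}(combs a) / => [r /LC_Lie_relP[c c2 ->]||a b _ Sa _ Sb|c a _ Sa|s a _ Sa].
- by rewrite combsK; apply: Lspan_gen; exists c.
- by rewrite (lin0 (@coords_linear k _)); apply: Lspan0.
- by rewrite (linD (@coords_linear k _)); apply: LspanD.
- by rewrite (linZ (@coords_linear k _)); apply: LspanZ.
rewrite -(coordsK a).
elim: {a}(coords a) / Sa => [v [c c2 ->]||u v _ Su _ Sv|c v _ Sv].
- have [e ->] := act_Col_coord s c; rewrite (linZ (@coords_linear k _)) combsK.
  by apply/LspanZ/Lspan_gen; exists c.
- rewrite (lin0 (@combs_linear k _)) (lin0 (op_act_linear s)) (lin0 (@coords_linear k _)).
  exact: Lspan0.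
- rewrite (linD (@combs_linear k _)) (linD (op_act_linear s)) (linD (@coords_linear k _)).
  exact: LspanD.
- rewrite (linZ (@combs_linear k _)) (linZ (op_act_linear s)) (linZ (@coords_linear k _)).
  exact: LspanZ.
Qed.

End LieCompatible.

Arguments Col_coord {k Omega} c.

Section LCBlack.
Variables (k : fieldType) (Omega : finType) (P : quadratic k).
Let L : quadratic k := LC Omega (Lie k).


(** The black product takes elements of the whole S_3-module generated by R, whereas LC relations
    come from R only; equivariance of the coloring maps bridges the two. *)
Lemma LC_ideal_Col c : is_C2 c -> forall a, q_relmod a ->
  ideal_gen (@q_rel k (LC Omega P)) 3 (\sum_(w | in_Col c w) color w (a : free_operad P 3)).
Proof.
move=> c2; apply: symspan_ideal => [|s a|a Ra].
- move=> e a b; rewrite scaler_sumr -big_split; apply: eq_bigr => w _.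
  exact: color_linear.
- rewrite (lin_sum (op_act_linear s)); apply: eq_bigr => w _; exact: color_act.
apply: In_ideal_gen; exists (coords a), c; split=> //; first by rewrite coordsK.
rewrite /color exchange_big; apply: eq_bigr => b _; by rewrite scaler_sumr.
Qed.

Lemma LC_black_iso : operad_iso (quadratic_operad (LC Omega P)) (quadratic_operad (black L P)).
Proof.
pose phi (x : LC Omega P) : black L P := ((x.1, tt), x.2).
pose psi (y : black L P) : LC Omega P := (y.1.1, y.2).
have phiK : cancel phi psi by case.
have psiK : cancel psi phi by move=> [[o []] x].
have phi_flip x y : flip (phi x) (phi y) = flip x y.
  (* The twist by sgn_2 cancels the sign of the flip on the Lie generator. *)
  by rewrite /= mulrN1 mulNr opprK.
have psi_flip x y : flip (psi x) (psi y) = flip x y by rewrite -phi_flip !psiK.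
have PsiE a (beta : {ffun comb3 P -> k^o}) i o o' x x' : Psi (tens a beta)
    (comb_map phi ((i, (o, x), (o', x')) : comb3 (LC Omega P))) =
    a ((i, (o, tt), (o', tt)) : comb3 L) * beta (i, x, x') :> k.
  by rewrite ffunE /= ffunE.
(* The black product of J_c with r colors r in all the ways allowed by c. *)
have Psi_Col c (beta : {ffun comb3 P -> k^o}) :
    combs [ffun d : comb3 (LC Omega P) => Psi (tens (Col_coord c) beta) (comb_map phi d)] =
    \sum_(w | in_Col c w) color w (combs beta).
  rewrite combs_colors [RHS]big_mkcond; apply: eq_bigr => w _; rewrite !color_combs.
  case: ifP => wc; last rewrite big1 //.
    apply: eq_bigr => -[[i x] y] _; rewrite ffunE ffunE PsiE ffunE /=.
    by rewrite -surjective_pairing wc mul1r.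
  move=> [[i x] y] _; rewrite ffunE ffunE PsiE ffunE /= -surjective_pairing wc mul0r.
  exact: scale0r.
apply: (quadratic_iso phiK psiK phi_flip) => r.
  move=> [alpha [c [Ra c2 ->]]]; apply: In_ideal_gen.
  exists (Col_coord c), alpha; split.
  - by apply/Symspan_gen/LC_Lie_relP; exists c.
  - exact: Symspan_gen.
  have -> : \sum_b alpha b *: \sum_(w | in_Col c w) colored b w =
      \sum_(w | in_Col c w) color w (combs alpha).
    under [RHS]eq_bigr => w _ do rewrite color_combs.
    by rewrite exchange_big; apply: eq_bigr => b _; rewrite scaler_sumr.
  rewrite -Psi_Col (free_map_combsE phiK psiK phi_flip); congr combs.
  by apply/ffunP => -[[i [[o []] x]] [[o' []] y]]; rewrite ffunE ffunE.
move=> [a [beta [Ra Rb ->]]].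
rewrite (free_map_combsE psiK phiK psi_flip).
(* With beta fixed the relation is linear in its Lie factor, so induction along the span of the J_c
   applies. *)
pose F (v : {ffun comb3 L -> k^o}) : free_operad (LC Omega P) 3 :=
  combs [ffun d => Psi (tens v beta) (comb_map phi d)].
have F_lin : linear F.
  move=> e u v; rewrite /F -combs_linear; congr combs.
  apply/ffunP => -[[i [o x]] [o' y]].
  by rewrite !ffunE /= !ffunE /= mulrDl scalerAl.
rewrite -[combs _]/(F a).
have {Ra} := LC_Lie_relmod Ra; elim=> {a} [v [c c2 ->]||u v _ Iu _ Iv|c v _ Iv].
- by rewrite /F Psi_Col; apply: LC_ideal_Col.
- by rewrite (lin0 F_lin); apply: in_sub0.
- by rewrite (linD F_lin); apply: in_subD.
- by rewrite (linZ F_lin); apply: in_subZ.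
Qed.

End LCBlack.

Lemma linear_sub (k : fieldType) (U V : lmodType k) (f g : U -> V) :
  linear f -> linear g -> linear (fun u => f u - g u).
Proof. by move=> lf lg c u v; rewrite lf lg scalerBr opprD addrACA. Qed.

(** * Relations of Com^TC and their pairings *)

Section ComCompatible.
Variables (k : fieldType) (Omega : finType).
Let T : quadratic k := TC Omega (Com k).
Implicit Types (c : {ffun Omega -> nat}) (w : Omega * Omega).

Definition Com_comb i w : comb3 T := (i, (w.1, tt), (w.2, tt)).

Lemma Com_combE i w : color_comb w ((i, tt, tt) : comb3 (triv_smod2 k)) = Com_comb i w.
Proof. by []. Qed.

Lemma Com_combP (b : comb3 T) : exists i w, b = Com_comb i w.
Proof. by case: b => [[i [o []]] [o' []]]; exists i, (o, o'). Qed.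

(** This is the pairing p_c. *)
Definition Com_pairing c (alpha : {ffun comb3 T -> k^o}) : k^o :=
  \sum_i \sum_(w | color_count w == c) alpha (Com_comb i w).

Lemma Com_pairing_linear c : linear (Com_pairing c).
Proof.
move=> e u v; rewrite /Com_pairing scaler_sumr -big_split; apply: eq_bigr => i _ /=.
rewrite scaler_sumr -big_split; apply: eq_bigr => w _ /=.
by rewrite !ffunE.
Qed.

Lemma Com_pairing_comb c i w :
  Com_pairing c (ffun1 (Com_comb i w)) = (color_count w == c)%:R :> k.
Proof.
have E i' w' : ffun1 (Com_comb i w) (Com_comb i' w') = ((i == i') && (w == w'))%:R :> k.
  rewrite ffunE; congr (_ %:R); congr nat_of_bool.
  apply/eqP/andP => [[-> e1 e2]|[/eqP -> /eqP ->] //].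
  by case: w w' e1 e2 => [a b] [a' b'] /= -> ->.
rewrite /Com_pairing (bigD1 i) //= [X in _ + X]big1 => [|i' /negPf ii']; last first.
  by apply: big1 => w' _; rewrite E eq_sym ii'.
rewrite addr0 big_mkcond (bigD1 w) //= big1 => [|w' /negPf ww']; last first.
  by case: ifP => // _; rewrite E eqxx eq_sym ww'.
by rewrite addr0 E !eqxx; case: ifP.
Qed.

Lemma Com_relE (alpha : {ffun comb3 (triv_smod2 k) -> k^o}) :
  @q_rel k (Com k) (combs alpha) <->
  exists i j, alpha = ffun1 ((i, tt, tt) : comb3 (triv_smod2 k)) -
                      ffun1 ((j, tt, tt) : comb3 (triv_smod2 k)).
Proof.
split=> -[i [j E]]; exists i, j; last first.
  by rewrite E (linB (@combs_linear k _)) !combs_ffun1.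
by rewrite -(combsK alpha) E (linB (@coords_linear k _)) !coords_lcomb.
Qed.

(** As S_2 acts trivially on the generator of Com, s just moves the position of a comb, and p_c sees
    only its labels. *)
Lemma act_Com_pairing c (s : 'S_3) (a : free_operad T 3) :
  Com_pairing c (coords (op_act s a)) = Com_pairing c (coords a).
Proof.
have flip_triv (x y : triv_smod2 k) : flip x y = (x == y)%:R * 1.
  by case: x y => [] [] /=; rewrite mul1r.
have [e [j [_ [/(_ erefl) -> H]]]] :=
  act_lcomb_scalar (@flip_copies_scalar k Omega _ _ flip_triv) s.
have lin := linear_comp (Com_pairing_linear c) (@coords_linear k T).
move: a; apply: (linear_comb_ext (linear_comp lin (op_act_linear s)) lin) => b.
have [i [w ->]] := Com_combP b; rewrite H scale1r !coords_lcomb.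
by rewrite -[(j i, _, _)]/(Com_comb (j i) w) !Com_pairing_comb.
Qed.

(** Every generating relation is a difference of two combs with the same multiset of labels, on
    which p_c takes equal values. *)
Lemma TC_Com_relmod c (a : free_operad T 3) :
  q_relmod a -> Com_pairing c (coords a) = 0.
Proof.
have lin := linear_comp (Com_pairing_linear c) (@coords_linear k T).
elim=> {a} [a [[alpha [mu [nu [R ->]]]]|[alpha [b [c' [d [t [_ _ dc tc ->]]]]]]]
           ||a b _ Sa _ Sb|e a _ Sa|s a _ Sa].
- have [i [j ->]] := (Com_relE alpha).1 R.
  rewrite -color_combs (linB (@combs_linear k _)) !combs_ffun1.
  rewrite (linB (color_linear _)) !color_lcomb !coloredE (linB lin) !coords_lcomb.
  by rewrite !Com_combE !Com_pairing_comb subrr.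
- case: b => [[i []] []]; rewrite !coloredE !Com_combE (linB lin) !coords_lcomb.
  move: dc tc; rewrite !Com_pairing_comb !in_ColE => /eqP -> /eqP ->.
  by rewrite subrr.
- exact: (lin0 lin).
- by rewrite (linD lin) Sa Sb addr0.
- by rewrite (linZ lin) Sa scaler0.
by rewrite act_Com_pairing.
Qed.

Lemma TC_Com_MT i j w : q_relmod (combs (ffun1 (Com_comb i w) - ffun1 (Com_comb j w))).
Proof.
apply: Symspan_gen; left.
exists (ffun1 ((i, tt, tt) : comb3 (triv_smod2 k)) -
        ffun1 ((j, tt, tt) : comb3 (triv_smod2 k))).
(* The leveled relation names the label of the root first, while w lists the upper vertex first. *)
exists w.2, w.1; split; first by apply/Com_relE; exists i, j.
rewrite -color_combs !(linB (@combs_linear k _)) !combs_ffun1.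
by rewrite (linB (color_linear _)) !color_lcomb !coloredE -surjective_pairing.
Qed.

Lemma TC_Com_TC i w w' : color_count w = color_count w' ->
  q_relmod (combs (ffun1 (Com_comb i w) - ffun1 (Com_comb i w'))).
Proof.
move=> ww'; apply: Symspan_gen; right.
(* A relation of Com in which the comb at i really occurs: its difference with the next comb, which
   is distinct. *)
exists (ffun1 ((i, tt, tt) : comb3 (triv_smod2 k)) -
        ffun1 ((ordS i, tt, tt) : comb3 (triv_smod2 k))).
exists (i, tt, tt), (color_count w), w, w'; split; rewrite ?in_ColE ?ww' ?is_C2_count //.
  split; first by apply/Com_relE; exists i, (ordS i).
  have /negPf ne : ordS i != i by case: i => -[|[|[|i]]].
  by rewrite !ffunE eqxx !xpair_eqE ne subr0 oner_neq0.
by rewrite !(linB (@combs_linear k _)) !combs_ffun1 !coloredE.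
Qed.

End ComCompatible.

(** * Recoloring modulo the TC relations, and the white product *)

Section TCWhite.
Variables (k : fieldType) (Omega : finType) (P : quadratic k).
Let T : quadratic k := TC Omega (Com k).
Implicit Types (c : {ffun Omega -> nat}) (w : Omega * Omega).

(** On R these are the leveled relations; equivariance of [color w] extends this to the S_3-module
    generated by R. *)
Lemma TC_ideal_color w a : q_relmod a ->
  ideal_gen (@q_rel k (TC Omega P)) 3 (color w (a : free_operad P 3)).
Proof.
apply: (symspan_ideal (color_linear w) (color_act w)) => r Rr.
apply: In_ideal_gen; left; exists (coords r), w.2, w.1.
by rewrite coordsK -surjective_pairing.
Qed.

(** With at most one label the two colorings coincide. Otherwise the difference is linear and
    equivariant in a, and on the trees occurring in R it is a TC relation. *)
Lemma TC_ideal_recolor w w' : ((1 < #|Omega|)%N -> trees_of_rel_generate P) ->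
  color_count w = color_count w' -> forall a : free_operad P 3,
  ideal_gen (@q_rel k (TC Omega P)) 3 (color w a - color w' a).
Proof.
move=> gen ww' a; have [small|/gen {}gen] := leqP #|Omega| 1.
  have -> : w = w'.
    have eqO := fintype_le1P small.
    by case: w w' {ww'} => [o1 o2] [o3 o4]; rewrite (eqO o1 o3) (eqO o2 o4).
  by rewrite subrr; apply: in_sub0.
move: a (gen a); apply: symspan_ideal => [|s a|a [alpha [b [Ra ab ->]]]].
- exact: linear_sub (color_linear w) (color_linear w').
- by rewrite !color_act (linB (op_act_linear s)).
apply: In_ideal_gen; right; exists alpha, b, (color_count w), w, w'.
by split; rewrite ?in_ColE ?is_C2_count ?ww' // !color_lcomb.
Qed.

(** The pairing p_c applied to the first tensor factor. *)
Definition contract c (t : tensor3 T P) : {ffun comb3 P -> k^o} :=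
  [ffun b => \sum_i \sum_(w | color_count w == c) t (Com_comb k i w, b)].

Lemma contract_linear c : linear (contract c).
Proof.
move=> e u v; apply/ffunP => b; rewrite !ffunE scaler_sumr -big_split.
apply: eq_bigr => i _ /=; rewrite scaler_sumr -big_split.
by apply: eq_bigr => w _ /=; rewrite !ffunE.
Qed.

Lemma contract_tens c alpha beta : contract c (tens alpha beta) = Com_pairing c alpha *: beta.
Proof.
apply/ffunP => b; rewrite !ffunE scaler_suml.
apply: eq_bigr => i _; rewrite scaler_suml.
by apply: eq_bigr => w _; rewrite ffunE.
Qed.

(** A pure tensor contracts to p_c(alpha) times beta: this is 0 if alpha is a relation of Com^TC,
    and a relation of P if beta is one. *)
Lemma contract_white c t : lspan (@white_tensor k T P) t -> q_relmod (combs (contract c t)).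
Proof.
have lin := linear_comp (@combs_linear k P) (contract_linear c).
elim=> {t} [t [alpha [beta [-> [Ra|Rb]]]]||u v _ Iu _ Iv|e v _ Iv].
- have := TC_Com_relmod c Ra; rewrite combsK contract_tens => ->.
  by rewrite scale0r (lin0 (@combs_linear k P)); apply: Symspan0.
- by rewrite contract_tens (linZ (@combs_linear k P)); apply: SymspanZ.
- by rewrite (lin0 lin); apply: Symspan0.
- by rewrite (linD lin); apply: SymspanD.
- by rewrite (linZ lin); apply: SymspanZ.
Qed.

End TCWhite.

Section TCWhiteIso.
Variables (k : fieldType) (Omega : finType) (P : quadratic k).
Let T : quadratic k := TC Omega (Com k).
Implicit Types (c : {ffun Omega -> nat}) (w : Omega * Omega).

Definition to_white (x : TC Omega P) : white T P := ((x.1, tt), x.2).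
Definition of_white (y : white T P) : TC Omega P := (y.1.1, y.2).

Lemma to_whiteK : cancel to_white of_white. Proof. by case. Qed.
Lemma of_whiteK : cancel of_white to_white. Proof. by move=> [[o []] x]. Qed.

Lemma to_white_flip x y : flip (to_white x) (to_white y) = flip x y.
Proof. by rewrite /= mulr1. Qed.

Lemma of_white_flip x y : flip (of_white x) (of_white y) = flip x y.
Proof. by rewrite -to_white_flip !of_whiteK. Qed.

(** The coordinates of the image of K_w under the bijection of generators, by [free_map_color]. *)
Definition white_coord w (beta : {ffun comb3 P -> k^o}) : {ffun comb3 (white T P) -> k^o} :=
  [ffun d : comb3 (white T P) =>
     ((d.1.2.1.1, d.2.1.1) == w)%:R * beta (d.1.1, d.1.2.2, d.2.2) : k].

Lemma free_map_color w beta :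
  free_map to_white (color w (combs beta)) = combs (white_coord w beta).
Proof.
have E : color w (combs beta) = combs [ffun d : comb3 (TC Omega P) =>
    ((d.1.2.1, d.2.1) == w)%:R * beta (d.1.1, d.1.2.2, d.2.2) : k].
  rewrite combs_colors (bigD1 w) //= [X in _ + X]big1 ?addr0 => [|w' /negPf ww'].
    congr (color w (combs _)); apply/ffunP => -[[i x] y].
    by rewrite !ffunE /= -surjective_pairing eqxx mul1r.
  rewrite [X in combs X](_ : _ = 0); last first.
    apply/ffunP => -[[i x] y]; rewrite !ffunE /= -surjective_pairing ww'.
    exact: mul0r.
  by rewrite (lin0 (@combs_linear k _)) (lin0 (color_linear _)).
rewrite E (free_map_combsE to_whiteK of_whiteK to_white_flip); congr combs.
by apply/ffunP => -[[i [[o []] x]] [[o' []] y]]; rewrite !ffunE.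
Qed.

Lemma Phi_white_coord w beta : Phi (white_coord w beta) =
  [ffun b : comb3 T * comb3 P => (b.1 == Com_comb k b.2.1.1 w)%:R * beta b.2 : k] :> tensor3 T P.
Proof.
apply/ffunP => -[[[i [o []]] [o' []]] [[j x] y]]; rewrite !ffunE /=.
have -> : ((i, (o, tt), (o', tt)) == Com_comb k j w) = (i == j) && ((o, o') == w).
  apply/eqP/andP => [[-> -> ->]|[/eqP -> /eqP <-]] //.
  by rewrite eqxx -surjective_pairing.
by case: eqP => [->|_] //=; rewrite mul0r.
Qed.

Lemma white_MT w alpha : q_rel (combs alpha) ->
  lspan (@white_tensor k T P) (Phi (white_coord w alpha)).
Proof.
(* Let R_i be the part of alpha at position i and e_i the comb of Com^TC at i colored by w. Phi
   gives the sum of the tensors of e_i with R_i. Replacing each e_i by e_0 costs relations of Com^TC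
   and leaves e_0 tensored with alpha. *)
move=> Ra; pose R (i : 'I_3) : {ffun comb3 P -> k^o} :=
  [ffun b : comb3 P => (b.1.1 == i)%:R * alpha b : k].
have -> : Phi (white_coord w alpha) = tens (ffun1 (Com_comb k ord0 w)) alpha +
    \sum_i tens (ffun1 (Com_comb k i w) - ffun1 (Com_comb k ord0 w)) (R i).
  rewrite Phi_white_coord; apply/ffunP => -[b [[j x] y]]; rewrite !ffunE sum_ffunE /=.
  rewrite (bigD1 j) //= [X in _ + (_ + X)]big1 => [|i /negPf ij].
    rewrite !ffunE /= eqxx mul1r addr0 mulrBl addrCA subrr addr0.
    by rewrite eq_sym.
  by rewrite !ffunE /= [j == i]eq_sym ij mul0r mulr0.
apply: LspanD; first by apply: Lspan_gen; do 2 eexists; split=> //; right; apply: Symspan_gen.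
elim/big_ind: _ => [|u v|i _]; [exact: Lspan0|exact: LspanD|].
by apply: Lspan_gen; do 2 eexists; split=> //; left; apply: TC_Com_MT.
Qed.

(** For a single comb, Phi gives a pure tensor whose factors sit at the same position, so the
    difference is a relation of Com^TC tensored with b. *)
Lemma white_TC b w w' : color_count w = color_count w' ->
  lspan (@white_tensor k T P) (Phi (white_coord w (ffun1 b) - white_coord w' (ffun1 b))).
Proof.
move=> ww'; case: b => [[i x] y]; set b := (i, x, y).
have -> : Phi (white_coord w (ffun1 b) - white_coord w' (ffun1 b)) =
    tens (ffun1 (Com_comb k i w) - ffun1 (Com_comb k i w')) (ffun1 b) :> tensor3 T P.
  have -> : Phi (white_coord w (ffun1 b) - white_coord w' (ffun1 b)) =
     Phi (white_coord w (ffun1 b)) - Phi (white_coord w' (ffun1 b)) :> tensor3 T P.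
    apply/ffunP => -[[[j z] z'] [[j' t] t']]; rewrite !ffunE /=.
    by case: (j =P j') => _; rewrite ?subrr.
  rewrite !Phi_white_coord; apply/ffunP => -[d d']; rewrite !ffunE /=.
  case: (b =P d') => [<-|_]; last by rewrite !mulr0 subrr.
  by rewrite !mulr1 ![_ == d]eq_sym.
by apply: Lspan_gen; do 2 eexists; split=> //; left; apply: TC_Com_TC.
Qed.

Lemma contract_Phi c (gamma : {ffun comb3 (white T P) -> k^o}) :
  contract c (Phi gamma) = \sum_(w | color_count w == c)
    [ffun b => gamma (comb_map to_white (color_comb w b))].
Proof.
apply/ffunP => -[[i x] y]; rewrite sum_ffunE ffunE (bigD1 i) //= [X in _ + X]big1.
  by rewrite addr0; apply: eq_bigr => w _; rewrite !ffunE /= ?eqxx.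
by move=> j /negPf ij; apply: big1 => w _; rewrite !ffunE /= ?ij.
Qed.

Lemma white_ideal gamma : ((1 < #|Omega|)%N -> trees_of_rel_generate P) ->
  lspan (@white_tensor k T P) (Phi gamma) ->
  ideal_gen (@q_rel k (TC Omega P)) 3 (free_map of_white (combs gamma)).
Proof.
move=> gen Wg; rewrite (free_map_combsE of_whiteK to_whiteK of_white_flip) combs_colors.
set I := ideal_gen _ 3.
pose g w := combs [ffun b => gamma (comb_map to_white (color_comb w b))].
(* A representative of the colorings with the same multiset of labels as w; the value of [choose]
   depends on the predicate only, not on the starting point. *)
pose rho w := choose (fun w' => color_count w' == color_count w) w.
have count_rho w : color_count (rho w) = color_count w.
  by apply/eqP; apply: (@chooseP _ (fun w' => color_count w' == color_count w)).
have rho_count w w' : color_count w = color_count w' -> rho w = rho w'.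
  move=> ww'; rewrite /rho ww'; apply: choose_id; exact/eqP.
(* Each coloring is replaced by its representative, at the cost of an element of the ideal. *)
have -> : \sum_w color w (combs [ffun b =>
      [ffun d => gamma (comb_map to_white d)] (color_comb w b)]) =
    \sum_w (color w (g w) - color (rho w) (g w)) + \sum_w color (rho w) (g w).
  rewrite -big_split; apply: eq_bigr => w _; rewrite /= subrK; congr (color w (combs _)).
  by apply/ffunP => b; rewrite !ffunE.
apply: in_subD.
  apply: in_sub_sum => w _; exact: TC_ideal_recolor.
(* The remaining terms are grouped by representative u; a u outside the image of rho gives an empty
   sum. *)
rewrite (partition_big rho xpredT) //; apply: in_sub_sum => u _.
have [/existsP[w0 /eqP w0u]|none] := boolP [exists w, rho w == u]; last first.
  rewrite big1; first exact: in_sub0.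
  by move=> w wu; case/existsP: none; exists w.
have eq_rho w : (rho w == u) = (color_count w == color_count u).
  apply/eqP/eqP => [<-|wu]; first by rewrite count_rho.
  by rewrite -w0u; apply: rho_count; rewrite wu -w0u count_rho.
(* Within a class all terms carry the coloring u, and the g_w add up to a contraction of Phi, which
   is a relation of P. *)
have -> : \sum_(w | rho w == u) color (rho w) (g w) =
    color u (combs (contract (color_count u) (Phi gamma))).
  rewrite contract_Phi (lin_sum (@combs_linear k P)) (lin_sum (color_linear u)).
  rewrite (eq_bigl _ _ eq_rho); apply: eq_bigr => w.
  by rewrite -eq_rho => /eqP ->.
exact/TC_ideal_color/contract_white.
Qed.

Lemma TC_white_iso : ((1 < #|Omega|)%N -> trees_of_rel_generate P) ->
  operad_iso (quadratic_operad (TC Omega P)) (quadratic_operad (white T P)).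
Proof.
move=> gen; apply: (quadratic_iso to_whiteK of_whiteK to_white_flip) => r.
  have lin := free_map_hom to_whiteK of_whiteK to_white_flip.
  case: lin => /(_ 3) lin _ _ _.
  case=> [[alpha [mu [nu [Ra ->]]]]|[alpha [b [c [d [t [_ _ dc tc ->]]]]]]]; apply: In_ideal_gen.
    exists (white_coord (nu, mu) alpha); split; first exact: white_MT.
    by rewrite -color_combs free_map_color.
  exists (white_coord d (ffun1 b) - white_coord t (ffun1 b)); split.
    by apply: white_TC; move: dc tc; rewrite !in_ColE => /eqP -> /eqP ->.
  by rewrite (linB (@combs_linear k _)) (linB lin) -!color_lcomb -!combs_ffun1 !free_map_color.
by case=> gamma [Wg ->]; apply: white_ideal.
Qed.

End TCWhiteIso.

Theorem proposition3p6 (k : fieldType) (char0 : [pchar k]%R =i pred0)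
    (Omega : finType) (Omega_gt0 : (0 < #|Omega|)%N) (P : quadratic k) :
  operad_iso (quadratic_operad (LC Omega P))
             (quadratic_operad (black (LC Omega (Lie k)) P)) /\
  (((1 < #|Omega|)%N -> trees_of_rel_generate P) ->
   operad_iso (quadratic_operad (TC Omega P))
              (quadratic_operad (white (TC Omega (Com k)) P))).
Proof. by split; [exact: LC_black_iso|exact: TC_white_iso]. Qed.
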